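(* For a selfadjoint contraction $X$ in an orthogonal sum $\mathcal K\oplus\mathcal H$ put $$\widehat Z_0(X)=\left((I+X)_{\mathcal K}-I\right)\upharpoonright\mathcal K,\qquad \widehat Z_1(X)=\left(I-(I-X)_{\mathcal K}\right)\upharpoonright\mathcal K .$$ 1) Let $\mathcal K,\mathcal H$ be Hilbert spaces with $\dim\mathcal K=\dim\mathcal H=\infty$. Then there exists a selfadjoint contractive block operator $$X=\begin{bmatrix}X_{11}&X_{12}\\ X_{12}^*&X_{22}\end{bmatrix}:\mathcal K\oplus\mathcal H\to\mathcal K\oplus\mathcal H$$ such that $(I-X)_{\mathcal H}=(I+X)_{\mathcal H}=0$, $\|X_{22}\|<1$, $\ker X_{12}^*=\{0\}$, and, with $\widehat Z_0=\widehat Z_0(X)$ and $\widehat Z_1=\widehat Z_1(X)$, $$\widehat Z_0\ne -I_{\mathcal K},\qquad \widehat Z_1\ne I_{\mathcal K},\qquad \ker(\widehat Z_1-\widehat Z_0)=\{0\}.$$ 2) Let $\dim\mathcal K=\infty$ and let $\widehat Z_0\le\widehat Z_1$ be two selfadjoint contractions in $\mathcal K$ satisfying $$\operatorname{ran}(\widehat Z_1-\widehat Z_0)^{1/2}\cap\operatorname{ran}(I+\widehat Z_0)^{1/2}=\{0\},\qquad \operatorname{ran}(\widehat Z_1-\widehat Z_0)^{1/2}\cap\operatorname{ran}(I-\widehat Z_1)^{1/2}=\{0\},$$ and $\ker(\widehat Z_1-\widehat Z_0)=\{0\}$. Then there exists a selfadjoint contractive block operator $X=\begin{bmatrix}X_{11}&X_{12}\\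 X_{12}^*&X_{22}\end{bmatrix}$ in a Hilbert space $\mathcal K\oplus\mathcal H$ with $\dim\mathcal H=\dim\mathcal K$ such that $$(I\pm X)_{\mathcal H}=0,\qquad \|X_{22}\|<1,$$ and $\widehat Z_0=\widehat Z_0(X)$, $\widehat Z_1=\widehat Z_1(X)$.
   Context: All Hilbert spaces are complex and separable. For a bounded nonnegative operator $S$ in a Hilbert space $L$ and a closed subspace $K\subseteq L$, the shorted operator is $S_K=\max\{Z\in\mathbf L(L):0\le Z\le S,\ \operatorname{ran}Z\subseteq K\}$; equivalently $(S_Kf,f)=\inf_{\varphi\in L\ominus K}(S(f+\varphi),f+\varphi)$, $f\in L$. The summands $\mathcal K$ and $\mathcal H$ are identified with the corresponding subspaces of $\mathcal K\oplus\mathcal H$. *)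

(* Defs.v *)
From HB Require Import structures.
From mathcomp Require Import all_boot all_order all_algebra sesquilinear.
From mathcomp Require Import complex.
From mathcomp Require Import all_classical all_reals all_analysis.
From mathcomp Require Import ring.

Set Implicit Arguments.
Unset Strict Implicit.
Unset Printing Implicit Defensive.

Import Order.TTheory GRing.Theory Num.Theory Num.Def.
Import numFieldNormedType.Exports.

Local Open Scope classical_set_scope.
Local Open Scope ring_scope.

(* The inner product is linear in its first argument. *)
HB.mixin Record CompleteNormedModule_isHilbert (R : realType) H
    of CompleteNormedModule R[i] H := {
  hdot : {dot H for (@conjC R[i])} ;
  hdot_normr : forall x : H, `|x| ^+ 2 = hdot x x }.

#[short(type="hilbertType")]
HB.structure Definition Hilbert (R : realType) :=
  { H of CompleteNormedModule R[i] H & CompleteNormedModule_isHilbert R H }.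

Section DirectSum.
Context {R : realType}.

Definition hsum (K H : hilbertType R) : Type := (K * H)%type.

Variables K H : hilbertType R.
Local Notation L := (hsum K H).
Local Notation C := R[i].

HB.instance Definition _ := GRing.Lmodule.copy L (K * H)%type.

Definition hsum_norm (x : L) : C := sqrtC (`|x.1| ^+ 2 + `|x.2| ^+ 2).

Lemma hsum_norm_ge0 x : 0 <= hsum_norm x.
Proof. by rewrite sqrtC_ge0 addr_ge0 ?exprn_ge0. Qed.

Lemma hsum_norm_sqr x : hsum_norm x ^+ 2 = `|x.1| ^+ 2 + `|x.2| ^+ 2.
Proof. exact: sqrtCK. Qed.

Lemma hsum_normD x y : hsum_norm (x + y) <= hsum_norm x + hsum_norm y.
Proof.
rewrite -(@ler_pXn2r _ 2) ?nnegrE ?addr_ge0 ?hsum_norm_ge0//.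
rewrite hsum_norm_sqr sqrrD !hsum_norm_sqr.
have h1 : `|(x + y).1| ^+ 2 <= (`|x.1| + `|y.1|) ^+ 2.
  by rewrite ler_pXn2r ?nnegrE ?addr_ge0// ler_normD.
have h2 : `|(x + y).2| ^+ 2 <= (`|x.2| + `|y.2|) ^+ 2.
  by rewrite ler_pXn2r ?nnegrE ?addr_ge0// ler_normD.
apply: (le_trans (lerD h1 h2)).
set p := `|x.1|; set q := `|x.2|; set r := `|y.1|; set s := `|y.2|.
have : [&& 0 <= p, 0 <= q, 0 <= r & 0 <= s] by rewrite /p /q /r /s !normr_ge0.
move=> /and4P[p0 q0 r0 s0].
have -> : (p + r) ^+ 2 + (q + s) ^+ 2 =
  (p ^+ 2 + q ^+ 2) + (p * r + q * s) *+ 2 + (r ^+ 2 + s ^+ 2).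
  by rewrite !sqrrD !mulr2n; ring.
rewrite lerD2r lerD2l lerMn2r /=.
rewrite -(@ler_pXn2r _ 2) ?nnegrE ?addr_ge0 ?mulr_ge0 ?hsum_norm_ge0//.
rewrite exprMn !hsum_norm_sqr -/p -/q -/r -/s -subr_ge0.
have -> : (p ^+ 2 + q ^+ 2) * (r ^+ 2 + s ^+ 2) - (p * r + q * s) ^+ 2 =
  (p * s - q * r) ^+ 2 by ring.
by apply: real_exprn_even_ge0 => //; apply: rpredB; apply: rpredM; exact: normr_real.
Qed.

Lemma hsum_normZ (l : C) x : hsum_norm (l *: x) = `|l| * hsum_norm x.
Proof.
apply/eqP; rewrite -(@eqrXn2 _ 2) ?hsum_norm_ge0 ?mulr_ge0 ?hsum_norm_ge0//.
by rewrite exprMn !hsum_norm_sqr /= !normrZ !exprMn mulrDr.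
Qed.

Lemma hsum_norm_eq0 x : hsum_norm x = 0 -> x = 0.
Proof.
move=> /(congr1 (fun z => z ^+ 2)); rewrite hsum_norm_sqr expr0n/=.
move=> /eqP; rewrite paddr_eq0 ?exprn_ge0// !expf_eq0/= !normr_eq0.
by case: x => x1 x2 /= /andP[/eqP -> /eqP ->].
Qed.

HB.instance Definition _ := Lmodule_isNormed.Build R[i] L
  hsum_normD hsum_normZ hsum_norm_eq0.

Lemma hsum_normE (x : L) : `|x| = hsum_norm x. Proof. by []. Qed.

Lemma hsum_norm_fst (x : L) : `|x.1| <= `|x|.
Proof.
rewrite -(@ler_pXn2r _ 2) ?nnegrE// hsum_normE hsum_norm_sqr.
by rewrite lerDl exprn_ge0.
Qed.

Lemma hsum_norm_snd (x : L) : `|x.2| <= `|x|.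
Proof.
rewrite -(@ler_pXn2r _ 2) ?nnegrE// hsum_normE hsum_norm_sqr.
by rewrite lerDr exprn_ge0.
Qed.

Lemma hsum_norm_le (x : L) : `|x| <= `|x.1| + `|x.2|.
Proof.
rewrite -(@ler_pXn2r _ 2) ?nnegrE ?addr_ge0// hsum_normE hsum_norm_sqr.
by rewrite sqrrD lerD2r lerDl mulrn_wge0// mulr_ge0.
Qed.

Lemma hsum_complete (F : set_system L) : ProperFilter F -> cauchy F -> cvg F.
Proof.
move=> FF /cauchy_ballP Fc.
have c1 : cvg (fst @ F).
  apply: cauchy_cvg; apply/cauchy_ballP => e e0.
  have [[A B] [/= FA FB] AB] := Fc e e0.
  exists (fst @` A, fst @` B); first by
    split; [apply: filterS FA|apply: filterS FB] => x ?; exists x.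
  move=> [_ _] [/= [x Ax <-] [y By <-]]; have /= := AB (x, y) (conj Ax By).
  rewrite -!ball_normE /ball_/=; apply: le_lt_trans.
  exact: (hsum_norm_fst (x - y)).
have c2 : cvg (snd @ F).
  apply: cauchy_cvg; apply/cauchy_ballP => e e0.
  have [[A B] [/= FA FB] AB] := Fc e e0.
  exists (snd @` A, snd @` B); first by
    split; [apply: filterS FA|apply: filterS FB] => x ?; exists x.
  move=> [_ _] [/= [x Ax <-] [y By <-]]; have /= := AB (x, y) (conj Ax By).
  rewrite -!ball_normE /ball_/=; apply: le_lt_trans.
  exact: (hsum_norm_snd (x - y)).
have [[k ck] [h ch]] := (proj1 (cvg_ex _) c1, proj1 (cvg_ex _) c2).
apply/cvg_ex; exists ((k, h) : L); apply/cvgrPdist_lt => e e0.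
have e20 : 0 < e / 2 by rewrite divr_gt0.
have {}ck := proj1 (cvgrPdist_lt _ _) ck _ e20.
have {}ch := proj1 (cvgrPdist_lt _ _) ch _ e20.
near=> x; apply: le_lt_trans (hsum_norm_le _) _; rewrite (splitr e).
by apply: ltrD; [near: x; exact: ck|near: x; exact: ch].
Unshelve. all: by end_near. Qed.

HB.instance Definition _ := Uniform_isComplete.Build L hsum_complete.

Definition hsum_dot (x y : L) : C := hdot x.1 y.1 + hdot x.2 y.2.

Lemma hsum_dot_bilinear :
  bilinear_for *%R ((@conjC C) \; *%R) hsum_dot.
Proof.
split=> [u' a x y|u a x y]; rewrite /hsum_dot /=.
  by rewrite !linearPl/= mulrDr addrACA.
by rewrite !linearPr/= mulrDr addrACA.
Qed.

HB.instance Definition _ := bilinear_isBilinear.Build C L L C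
  *%R ((@conjC C) \; *%R) hsum_dot hsum_dot_bilinear.

Lemma hsum_dot_hermitian (x y : L) :
  hsum_dot x y = (-1) ^+ false * conjC (hsum_dot y x).
Proof.
rewrite expr0 mul1r /hsum_dot rmorphD/=.
by rewrite (hermC hdot x.1 y.1) (hermC hdot x.2 y.2) /= !expr0 !mul1r.
Qed.

HB.instance Definition _ := isHermitianSesquilinear.Build C L false
  (@conjC C) hsum_dot hsum_dot_hermitian.

Lemma hsum_hdot_normr (x : L) : `|x| ^+ 2 = hsum_dot x x.
Proof. by rewrite hsum_normE hsum_norm_sqr !hdot_normr. Qed.

Lemma hsum_dot_gt0 (x : L) : x != 0 -> 0 < hsum_dot x x.
Proof. by move=> x0; rewrite -hsum_hdot_normr exprn_gt0// normr_gt0. Qed.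

HB.instance Definition _ := isDotProduct.Build C L hsum_dot hsum_dot_gt0.

HB.instance Definition _ := CompleteNormedModule_isHilbert.Build R L
  hsum_hdot_normr.

End DirectSum.

Definition separable_space (T : topologicalType) := exists A : set T, countable A /\ dense A.

Section Dimension.
Context {R : realType}.

Definition orthonormal_basis (H : hilbertType R) (B : set H) :=
  (forall x y, B x -> B y -> hdot x y = (x == y)%:R) /\
  (forall x, (forall b, B b -> hdot x b = 0) -> x = 0).

(* The cardinality of an orthonormal basis does not depend on the basis, so
   existential quantification over bases is harmless. *)
Definition hdim_infinite (H : hilbertType R) :=
  exists B : set H, orthonormal_basis B /\ infinite_set B.

Definition hdim_eq (H K : hilbertType R) :=
  exists (B : set H) (B' : set K),
    [/\ orthonormal_basis B, orthonormal_basis B' & (B #= B')%card].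

End Dimension.

Section Operators.
Context {R : realType}.
Implicit Types U V : hilbertType R.

(* Operators are plain functions; membership in L(U, V) is this predicate. *)
Definition bounded_op U V (T : U -> V) := linear T /\ continuous T.

Definition opnorm U V (T : U -> V) : R :=
  sup [set complex.Re `|T x| | x in [set x : U | `|x| <= 1]].

Definition contractive U (T : U -> U) :=
  bounded_op T /\ forall x, `|T x| <= `|x|.

Definition selfadjoint U (T : U -> U) :=
  bounded_op T /\ forall x y, hdot (T x) y = hdot x (T y).

(* The order of R[i] compares only numbers with the same imaginary part, so
   op_le (cst 0) T forces all the values of the form of T to be real. *)
Definition op_le U (S T : U -> U) := forall f, hdot (S f) f <= hdot (T f) f.

Definition nonnegative U (T : U -> U) := bounded_op T /\ op_le (cst 0) T.

Definition op_ker U V (T : U -> V) : set U := T @^-1` [set 0].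

(* The adjoint, the square root and the shorted operator are picked by xget.
   They exist and are unique for every bounded T, every nonnegative A and
   every nonnegative S with closed subspace M, so the default is never used. *)

Definition is_adjoint U V (T : U -> V) (T' : V -> U) :=
  bounded_op T' /\ forall x y, hdot (T x) y = hdot x (T' y).

Definition adjoint U V (T : U -> V) : V -> U := xget (cst 0) (is_adjoint T).

Definition is_op_sqrt U (A B : U -> U) := nonnegative B /\ B \o B = A.

Definition op_sqrt U (A : U -> U) : U -> U := xget (cst 0) (is_op_sqrt A).

Definition below_in U (S : U -> U) (M : set U) : set (U -> U) :=
  [set Z | [/\ nonnegative Z, op_le Z S & range Z `<=` M]].

Definition is_shorted U (S : U -> U) (M : set U) (Z : U -> U) :=
  below_in S M Z /\ forall W, below_in S M W -> op_le W Z.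

(* Default idfun: shorted S M = cst 0 then never holds by default. *)
Definition shorted U (S : U -> U) (M : set U) : U -> U :=
  xget (idfun : U -> U) (is_shorted S M).

End Operators.

Section BlockOperators.
Context {R : realType}.
Variables K H : hilbertType R.

Definition summand1 : set (hsum K H) := [set x | x.2 = 0].

Definition summand2 : set (hsum K H) := [set x | x.1 = 0].

Definition block_op (X11 : K -> K) (X12 : H -> K) (X21 : K -> H) (X22 : H -> H)
    (x : hsum K H) : hsum K H :=
  (X11 x.1 + X12 x.2, X21 x.1 + X22 x.2).

(* T maps summand1 to itself in the intended uses, so .1 is a corestriction. *)
Definition restrict1 (T : hsum K H -> hsum K H) (k : K) : K := (T (k, 0)).1.

Definition Zhat0 (X : hsum K H -> hsum K H) : K -> K :=
  restrict1 (shorted (idfun \+ X) summand1 \- idfun).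

Definition Zhat1 (X : hsum K H -> hsum K H) : K -> K :=
  restrict1 (idfun \- shorted (idfun \- X) summand1).

End BlockOperators.

Arguments summand1 {R} K H.
Arguments summand2 {R} K H.

(* Main.v *)
(* Take [X22 = 0] and [D = X12].  The Schur complements of [I + X] and [I - X] on [K]
   are [A1 = I + X11 - D D^*] and [A2 = I - X11 - D D^*], and they are the shorted
   operators to [K]; hence [Zhat0 = X11 - D D^*] and [Zhat1 = X11 + D D^*].  The form of
   [I + X] at [(k, h)] is [(A1 k, k) + |h + D^* k|^2], so for a factorization
   [A1 = T1 T1^*] the shorted operator to [H] vanishes as soon as the pairs
   [(D^* k, T1^* k)] approximate every [(h, 0)]; by the projection theorem this holds when
   [D] is injective and [ran D] meets [ran T1] only in [0].  The same applies to [I - X].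

   Part 2: [H = K], [X11 = (Z0 + Z1)/2], [D = ((Z1 - Z0)/2)^(1/2)], and [T1], [T2] are the
   square roots of [I + Z0], [I - Z1].

   Part 1: identify [H] with [K] by a unitary, choose a selfadjoint contraction [D] and a
   selfadjoint unitary [J] such that [ran D] meets both eigenspaces of [J] only in [0],
   and put [S = (I - D^2)^(1/2)], [X11 = S J S].  Then [A1], [A2] are [2 S Q S] with [Q]
   the projections [(I + J)/2], [(I - J)/2], and [D a = S b] with [J b = b] or [J b = - b]
   gives [b = S^2 b + D^2 b = D (S a + D b)], hence [b = 0]. *)
Require Import Defs.
From mathcomp Require Import all_boot all_order all_algebra sesquilinear.
From mathcomp Require Import complex.
From mathcomp Require Import all_classical all_reals all_analysis.
From mathcomp Require Import ring lra zify.

Set Implicit Arguments.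
Unset Strict Implicit.
Unset Printing Implicit Defensive.

Import Order.TTheory GRing.Theory Num.Theory Num.Def.
Import numFieldNormedType.Exports.

Local Open Scope classical_set_scope.
Local Open Scope ring_scope.
Local Open Scope complex_scope.

(** * Real inner product and norm *)

Section RealStructure.
Context {R : realType}.
Implicit Types H : hilbertType R.

(** Estimates are carried out on real parts, inside the ordered field [R]; [Im_hdot] recovers the
    full complex form. *)
Definition rdot H (x y : H) : R := complex.Re (hdot x y).
Definition rnorm H (x : H) : R := complex.Re `|x|.

Lemma rnormE H (x : H) : (rnorm x)%:C = `|x|.
Proof. by rewrite /rnorm RRe_real// ger0_real. Qed.

Lemma rnorm_ge0 H (x : H) : 0 <= rnorm x.
Proof. by rewrite -ler0c rnormE. Qed.

Lemma hdotC H (x y : H) : hdot x y = conjC (hdot y x).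
Proof. by rewrite (hermC hdot x y) expr0 mul1r. Qed.

Lemma rdotC H (x y : H) : rdot x y = rdot y x.
Proof. by rewrite /rdot hdotC; case: (hdot y x). Qed.

Lemma rdotDl H (x y z : H) : rdot (x + y) z = rdot x z + rdot y z.
Proof. by rewrite /rdot linearDl raddfD. Qed.

Lemma rdotNl H (x z : H) : rdot (- x) z = - rdot x z.
Proof. by rewrite /rdot linearNl raddfN. Qed.

Lemma hdotZl H c (x z : H) : hdot (c *: x) z = c * hdot x z.
Proof. exact: linearZl_LR. Qed.

Lemma rdotZl H (a : R) (x z : H) : rdot (a%:C *: x) z = a * rdot x z.
Proof. by rewrite /rdot hdotZl; case: (hdot x z) => u v /=; rewrite mul0r subr0. Qed.

Lemma rdotDr H (x y z : H) : rdot z (x + y) = rdot z x + rdot z y.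
Proof. by rewrite !(rdotC z) rdotDl. Qed.

Lemma rdotNr H (x z : H) : rdot z (- x) = - rdot z x.
Proof. by rewrite !(rdotC z) rdotNl. Qed.

Lemma rdotZr H (a : R) (x z : H) : rdot z (a%:C *: x) = a * rdot z x.
Proof. by rewrite !(rdotC z) rdotZl. Qed.

Lemma rdot0l H (x : H) : rdot 0 x = 0.
Proof. by rewrite -(scale0r x) (_ : 0 = 0%:C)// rdotZl mul0r. Qed.

Lemma rdot0r H (x : H) : rdot x 0 = 0.
Proof. by rewrite rdotC rdot0l. Qed.

Definition rdotE := (rdotDl, rdotDr, rdotNl, rdotNr, rdotZl, rdotZr, rdot0l, rdot0r).

Lemma Im_hdot H (x y : H) : complex.Im (hdot x y) = - rdot ('i *: x) y.
Proof. by rewrite /rdot hdotZl; case: (hdot x y) => u v /=; rewrite !mul0r !mul1r add0r opprK. Qed.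

Lemma rnorm_sqr H (x : H) : rnorm x ^+ 2 = rdot x x.
Proof. by rewrite /rdot -hdot_normr -rnormE -rmorphXn/=. Qed.

Lemma rdot_ge0 H (x : H) : 0 <= rdot x x.
Proof. by rewrite -rnorm_sqr sqr_ge0. Qed.

Lemma hdotxx H (x : H) : hdot x x = (rdot x x)%:C.
Proof. by rewrite -rnorm_sqr -hdot_normr -rnormE rmorphXn. Qed.

Lemma rnorm_eq0 H (x : H) : rnorm x = 0 -> x = 0.
Proof. by move=> x0; apply/eqP; rewrite -normr_eq0 -rnormE x0. Qed.

Lemma rdot_eq0 H (x : H) : rdot x x <= 0 -> x = 0.
Proof.
move=> x0; apply: rnorm_eq0; apply/eqP; rewrite -sqrf_eq0 rnorm_sqr.
by rewrite eq_le x0 rdot_ge0.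
Qed.

Lemma rnorm_le H (x y : H) : (rnorm x <= rnorm y) = (rdot x x <= rdot y y).
Proof. by rewrite -!rnorm_sqr ler_pXn2r// nnegrE rnorm_ge0. Qed.

Lemma rnormD H (x y : H) : rnorm (x + y) <= rnorm x + rnorm y.
Proof. by rewrite -lecR rmorphD/= !rnormE ler_normD. Qed.

Lemma rnormN H (x : H) : rnorm (- x) = rnorm x.
Proof. by rewrite /rnorm normrN. Qed.

Lemma rnormB H (x y : H) : rnorm (x - y) <= rnorm x + rnorm y.
Proof. by rewrite -(rnormN y) rnormD. Qed.

Lemma rnorm_distC H (x y : H) : rnorm (x - y) = rnorm (y - x).
Proof. by rewrite -rnormN opprB. Qed.

Lemma rnormZ H (a : R) (x : H) : rnorm (a%:C *: x) = `|a| * rnorm x.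
Proof.
by apply: complexI; rewrite rnormE normrZ rmorphM/= rnormE normc_def/= expr0n addr0 sqrtr_sqr.
Qed.

Lemma rnorm0 H : rnorm (0 : H) = 0.
Proof. by rewrite /rnorm normr0. Qed.


(** Cauchy-Schwarz: the squared norm of [|y| x - |x| y] is [2 |x| |y| (|x| |y| - rdot x y)]; zero
    vectors are treated apart to allow the division. *)
Lemma rdot_le H (x y : H) : rdot x y <= rnorm x * rnorm y.
Proof.
have := rdot_ge0 ((rnorm y)%:C *: x - (rnorm x)%:C *: y).
rewrite !rdotE (rdotC y x) -!rnorm_sqr.
have := rnorm_ge0 x; rewrite le_eqVlt => /predU1P[/esym/rnorm_eq0->|x0].
  by move=> _; rewrite rdot0l rnorm0 mul0r.
have := rnorm_ge0 y; rewrite le_eqVlt => /predU1P[/esym/rnorm_eq0->|y0].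
  by move=> _; rewrite rdot0r rnorm0 mulr0.
move=> h; have xy0 := mulr_gt0 x0 y0.
by rewrite -(ler_pM2l xy0) -subr_ge0; lra.
Qed.

Lemma ler_norm_rdot H (x y : H) : `|rdot x y| <= rnorm x * rnorm y.
Proof. by rewrite ler_norml rdot_le andbT lerNl -rdotNl -(rnormN x) rdot_le. Qed.

Lemma rdot_nondeg H (x y : H) : (forall z, rdot x z = rdot y z) -> x = y.
Proof.
move=> xy; apply/eqP; rewrite -subr_eq0; apply/eqP/rdot_eq0.
by rewrite rdotDl rdotNl xy subrr.
Qed.

(** * Convergence and completeness in terms of the real norm *)

Lemma cvg_rnorm H (u : nat -> H) (l : H) :
  (rnorm (u n - l) @[n --> \oo] --> (0 : R)) <-> (u @ \oo --> l).
Proof.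
split=> [/cvgr0Pnorm_lt h|/cvgrPdist_lt h].
  apply/cvgrPdist_lt => e e0; have e0' := e0; move: e0.
  rewrite ltcE /= => /andP[/eqP eI eR].
  have := h _ eR; apply: filterS => n; rewrite ger0_norm ?rnorm_ge0// => ?.
  by rewrite distrC -rnormE ltcE/= eI eqxx.
apply/cvgr0Pnorm_lt => e e0; have := h e%:C; rewrite ltcR => /(_ e0).
apply: filterS => n; rewrite distrC -rnormE ltcR => ?.
by rewrite ger0_norm ?rnorm_ge0.
Qed.

Lemma cvg_rnorm_le H (u : nat -> H) (l : H) (s : nat -> R) :
  (forall n, rnorm (u n - l) <= s n) -> s @ \oo --> 0 -> u @ \oo --> l.
Proof.
move=> us s0; apply/cvg_rnorm; apply: (squeeze_cvgr _ (cvg_cst 0) s0).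
by apply: nearW => n; rewrite rnorm_ge0 us.
Qed.

Lemma cvg_dominated (a d : nat -> R) (l : R) :
  (forall n, `|a n - l| <= d n) -> d @ \oo --> 0 -> a @ \oo --> l.
Proof.
move=> ad /cvgr0Pnorm_lt d0; apply/cvgrPdist_lt => e e0.
apply: filterS (d0 _ e0) => n; rewrite distrC; apply: le_lt_trans.
by rewrite (le_trans (ad n))// ler_norm.
Qed.

Lemma cvg_rdotl H (u : nat -> H) (l z : H) : u @ \oo --> l ->
  rdot (u n) z @[n --> \oo] --> rdot l z.
Proof.
move=> /cvg_rnorm ul.
apply: (@cvg_dominated _ (fun n => rnorm (u n - l) * rnorm z)) => [n|].
  by rewrite -rdotNl -rdotDl ler_norm_rdot.
by rewrite -(mul0r (rnorm z)); apply: cvgMl.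
Qed.

Lemma cvg_rdotr H (u : nat -> H) (l z : H) : u @ \oo --> l ->
  rdot z (u n) @[n --> \oo] --> rdot z l.
Proof. by move=> /(@cvg_rdotl _ _ _ z); rewrite rdotC; under eq_fun do rewrite rdotC. Qed.

Lemma cvg_rnorm_lim H (u : nat -> H) (l : H) : u @ \oo --> l ->
  rnorm (u n) @[n --> \oo] --> rnorm l.
Proof.
move=> /cvg_rnorm ul; apply: cvg_dominated ul => n.
have := rnormD (l - u n) (u n); have := rnormD (u n - l) l.
rewrite !subrK (rnorm_distC l) ler_norml; lra.
Qed.

(** Two terms beyond [N] both lie within [s N] of [u N], so it suffices that [s N] is below half the
    radius. *)
Lemma complete_rnorm H (u : nat -> H) (s : nat -> R) :
  (forall n m, (n <= m)%N -> rnorm (u m - u n) <= s n) -> s @ \oo --> 0 ->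
  exists l : H, u @ \oo --> l.
Proof.
move=> us s0; apply/cvg_ex; apply: cauchy_cvg; apply/cauchy_ballP => e e0.
move: (e0); rewrite ltcE /= => /andP[/eqP eI eR].
have e2 : 0 < complex.Re e / 2 by lra.
have [N _ hN] := (cvgr0Pnorm_lt _).1 s0 _ e2.
exists ([set u n | n in [set n | (N <= n)%N]], [set u n | n in [set n | (N <= n)%N]]).
  by split; exists N => // n Nn /=; exists n.
move=> [_ _] [/= [n Nn <-] [m Nm <-]].
rewrite -ball_normE /ball_/= -rnormE ltcE/= eI eqxx/=.
have h1 := us _ _ Nn; have h2 := us _ _ Nm.
have := hN N (leqnn N) => /=; rewrite ltr_norml => /andP[_ h3].
have := rnormB (u n - u N) (u m - u N); rewrite opprB addrA subrK => h4; lra.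
Qed.

End RealStructure.

(** * Linear operators *)

Section LinearOperators.
Context {R : realType}.
Implicit Types U V W : hilbertType R.

Lemma lin_add U V (T : U -> V) : linear T -> forall x y, T (x + y) = T x + T y.
Proof. by move=> lT x y; rewrite -{1}(scale1r x) lT scale1r. Qed.

Lemma lin0 U V (T : U -> V) : linear T -> T 0 = 0.
Proof. by move=> /lin_add/(_ 0 0)/esym; rewrite addr0 => /(canRL (addrK _)); rewrite subrr. Qed.

Lemma lin_scale U V (T : U -> V) : linear T -> forall a x, T (a *: x) = a *: T x.
Proof. by move=> lT a x; rewrite -[a *: x]addr0 lT lin0// addr0. Qed.

Lemma lin_opp U V (T : U -> V) : linear T -> forall x, T (- x) = - T x.
Proof. by move=> lT x; rewrite -(scaleN1r x) lin_scale// scaleN1r. Qed.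

Lemma lin_sub U V (T : U -> V) : linear T -> forall x y, T (x - y) = T x - T y.
Proof. by move=> lT x y; rewrite lin_add// lin_opp. Qed.

Lemma bounded_op_rnorm U V (T : U -> V) (c : R) : linear T ->
  (forall x, rnorm (T x) <= c * rnorm x) -> bounded_op T.
Proof.
move=> lT cT; split=> // x; apply/cvgrPdist_lt => e e0.
(* The sign of [c] is arbitrary; [|c| + 1] is a larger constant by which one can divide. *)
have c0 : 0 < (`|c| + 1)%:C by rewrite ltcR; have := normr_ge0 c; lra.
have : \forall y \near x, `|x - y| < e / (`|c| + 1)%:C.
  by apply: cvgr_dist_lt => //; rewrite divr_gt0.
apply: filterS => y; rewrite ltr_pdivlMr// => h; apply: le_lt_trans h.
rewrite -lin_sub// -!rnormE -rmorphM lecR (le_trans (cT _))// mulrC.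
by rewrite ler_wpM2l ?rnorm_ge0//; have := ler_norm c; lra.
Qed.

Lemma bounded_op_id U : bounded_op (idfun : U -> U).
Proof. by split=> // x; apply: cvg_id. Qed.

Lemma bounded_op0 U V : bounded_op (cst 0 : U -> V).
Proof. by split=> [a x y|x]; [rewrite /= scaler0 addr0|exact: cvg_cst]. Qed.

Lemma bounded_opD U V (S T : U -> V) :
  bounded_op S -> bounded_op T -> bounded_op (S \+ T).
Proof.
move=> [lS cS] [lT cT]; split=> [a x y|x] /=; last by apply: cvgD; [exact: cS|exact: cT].
by rewrite lS lT scalerDr addrACA.
Qed.

Lemma bounded_opZ U V a (T : U -> V) : bounded_op T -> bounded_op (a \*: T).
Proof.
move=> [lT cT]; split=> [b x y|x] /=; last by apply: cvgZ; [exact: cvg_cst|exact: cT].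
by rewrite lT scalerDr !scalerA mulrC.
Qed.

Lemma bounded_opB U V (S T : U -> V) :
  bounded_op S -> bounded_op T -> bounded_op (S \- T).
Proof.
move=> bS /(bounded_opZ (-1))/(bounded_opD bS).
by congr bounded_op; apply/funext => x /=; rewrite scaleN1r.
Qed.

Lemma bounded_op_comp U V W (S : V -> W) (T : U -> V) :
  bounded_op S -> bounded_op T -> bounded_op (S \o T).
Proof.
move=> [lS cS] [lT cT]; split=> [a x y|x] /=; first by rewrite lT lS.
exact: (continuous_comp (cT x) (cS (T x))).
Qed.

(** Imaginary parts of the form are real parts at ['i *: x], so linearity of [T] turns the real
    identity into the complex one. *)
Lemma hdot_adjoint U V (T : U -> V) (T' : V -> U) : linear T ->
  (forall x y, rdot (T x) y = rdot x (T' y)) ->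
  forall x y, hdot (T x) y = hdot x (T' y).
Proof.
move=> lT TT' x y; apply/eqP; rewrite eq_complex -!/(rdot _ _) TT' eqxx/=.
by rewrite !Im_hdot -lin_scale// TT'.
Qed.

Lemma linear_adjoint U V (T : U -> V) (T' : V -> U) : linear T ->
  (forall x y, rdot (T x) y = rdot x (T' y)) -> linear T'.
Proof.
move=> lT /(hdot_adjoint lT) TT' a x y.
apply: rdot_nondeg => z; rewrite rdotC (rdotC _ z) /rdot -TT'.
by rewrite !linearDr !linearZr_LR/= !TT'.
Qed.

Lemma adjoint_eq U V (T : U -> V) (T' : V -> U) : linear T -> bounded_op T' ->
  (forall x y, rdot (T x) y = rdot x (T' y)) -> adjoint T = T'.
Proof.
move=> lT bT' TT'; apply: xget_unique => [|T'' [_ h]].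
  by split => //; exact: hdot_adjoint.
by apply/funext => y; apply: rdot_nondeg => x; rewrite !(rdotC _ x) -TT' /rdot h.
Qed.

Definition rsym U (T : U -> U) := forall x y, rdot (T x) y = rdot x (T y).

Lemma selfadjointP U (T : U -> U) :
  selfadjoint T <-> bounded_op T /\ rsym T.
Proof.
split=> -[bT hT]; split=> // x y; first by rewrite /rdot hT.
by apply: hdot_adjoint => //; case: bT.
Qed.

Lemma Im_hdot_sym U (T : U -> U) x : linear T -> rsym T -> complex.Im (hdot (T x) x) = 0.
Proof.
move=> lT sT; have := hdotC (T x) x; rewrite (hdot_adjoint lT sT).
by case: (hdot x (T x)) => a b /= [] ?; lra.
Qed.

(** The order of [R[i]] also asks for equal imaginary parts; for symmetric operators these are
    zero. *)
Lemma op_leP U (S T : U -> U) : linear S -> rsym S -> linear T -> rsym T ->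
  op_le S T <-> forall x, rdot (S x) x <= rdot (T x) x.
Proof.
move=> lS sS lT sT; split=> h x; first by have := h x; rewrite lecE => /andP[].
by rewrite lecE !Im_hdot_sym// eqxx; exact: h.
Qed.

Lemma linear_cst0 U V : linear (cst 0 : U -> V).
Proof. by case: (bounded_op0 U V). Qed.

Lemma rsym_cst0 U : rsym (cst 0 : U -> U).
Proof. by move=> x y; rewrite !rdotE. Qed.

Lemma nonnegativeI U (T : U -> U) : bounded_op T -> rsym T ->
  (forall x, 0 <= rdot (T x) x) -> nonnegative T.
Proof.
move=> bT sT hT; split=> //; apply/op_leP => //.
- exact: linear_cst0.
- exact: rsym_cst0.
- by case: bT.
- by move=> x; rewrite rdot0l.
Qed.

Lemma rdot_i U (x y : U) : rdot ('i *: x) ('i *: y) = rdot x y.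
Proof.
rewrite /rdot hdotZl linearZr_LR/=; case: (hdot x y) => a b /=; ring.
Qed.

(* Polarization over the complex field: the form of a nonnegative operator is real. *)
Lemma nonnegative_sym U (T : U -> U) : nonnegative T -> rsym T.
Proof.
move=> [[lT _] pT].
have im0 x : complex.Im (hdot (T x) x) = 0.
  by have := pT x; rewrite linear0l lecE/= => /andP[/eqP].
have im x y : complex.Im (hdot (T x) y) + complex.Im (hdot (T y) x) = 0.
  have := im0 (x + y); rewrite lin_add// !linearDl !linearDr !raddfD/= !im0; lra.
move=> x y; have := im ('i *: x) y; rewrite lin_scale// !Im_hdot scalerA -expr2.
rewrite sqr_i scaleN1r rdotNl opprK rdot_i (rdotC x); lra.
Qed.

Lemma nonnegative_ge0 U (T : U -> U) : nonnegative T -> forall x, 0 <= rdot (T x) x.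
Proof. by move=> [_ pT] x; have := pT x; rewrite linear0l lecE => /andP[]. Qed.

(** Polarization at [x + y]: by symmetry the two cross terms coincide, so the real form determines
    the operator. *)
Lemma eq_op_form U (S T : U -> U) : linear S -> rsym S -> linear T -> rsym T ->
  (forall x, rdot (S x) x = rdot (T x) x) -> S = T.
Proof.
move=> lS sS lT sT ST; apply/funext => x; apply: rdot_nondeg => y.
have := ST (x + y); rewrite !lin_add// !rdotE !ST (sS y x) (sT y x).
rewrite (rdotC y) (rdotC y); lra.
Qed.

Lemma opnorm0 U V : opnorm (cst 0 : U -> V) = 0.
Proof.
rewrite /opnorm (_ : [set _ | _ in _] = [set 0]) ?sup1//.
by apply/seteqP; split=> [_ [x _ <-]|_ ->] /=; rewrite ?normr0//; exists 0; rewrite //= normr0.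
Qed.

End LinearOperators.

(** * Orthogonality and density, square roots *)

Section Completeness.
Context {R : realType}.
Implicit Types U V : hilbertType R.

Lemma cvg_le (a b : nat -> R) (la lb : R) :
  a @ \oo --> la -> b @ \oo --> lb -> (forall n, a n <= b n) -> la <= lb.
Proof. by move=> ala blb ab; apply: (ler_cvg_to ala blb); exact: nearW. Qed.

Lemma cvg_rdot2 U (u : nat -> U) (l : U) : u @ \oo --> l ->
  rdot (u n) (u n) @[n --> \oo] --> rdot l l.
Proof.
move=> /cvg_rnorm_lim ul; rewrite -rnorm_sqr; under eq_fun do rewrite -rnorm_sqr expr2.
by rewrite expr2; apply: cvgM.
Qed.

Lemma half_add U (x : U) : (2^-1)%:C *: (x + x) = x.
Proof.
by rewrite scalerDr -scalerDl -rmorphD (_ : 2^-1 + 2^-1 = 1) ?scale1r//; lra.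
Qed.

(** The projection theorem for a real subspace [V], closed or not: the residuals of a minimizing
    sequence converge to a vector [p] orthogonal to [V], and the last hypothesis forces [p = 0]. *)
Lemma dense_of_orthogonal U (V : set U) (z : U) : V 0 ->
  (forall x y, V x -> V y -> V (x + y)) ->
  (forall (a : R) x, V x -> V (a%:C *: x)) ->
  (forall p, (forall v, V v -> rdot p v = 0) -> rdot p z = 0) ->
  forall e : R, 0 < e -> exists2 v, V v & rnorm (z - v) < e.
Proof.
move=> V0 VD VZ Vperp.
pose E := [set rdot (z - v) (z - v) | v in V].
have Elb : has_inf E.
  split; first by exists (rdot (z - 0) (z - 0)); exists 0.
  by exists 0 => _ [v _ <-]; exact: rdot_ge0.
pose d := inf E.
have dE v : V v -> d <= rdot (z - v) (z - v).
  by move=> Vv; apply: ge_inf; [case: Elb|exists v].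
have h0 n : 0 < (harmonic n : R) by rewrite invr_gt0.
(* With this precision the parallelogram law, applied to the midpoint of [v n] and [v m], gives
   exactly the Cauchy bound [harmonic n]. *)
have /choice[v hv] (n : nat) :
    exists v, V v /\ rdot (z - v) (z - v) < d + (harmonic n ^+ 2) / 4.
  have [|_ [v Vv <-]] := @inf_adherent _ E (harmonic n ^+ 2 / 4) _ Elb.
    by rewrite divr_gt0// exprn_gt0.
  by exists v.
have Vv n : V (v n) by case: (hv n).
pose u n := z - v n.
have uu n m : (n <= m)%N -> rnorm (u m - u n) <= harmonic n.
  move=> nm; rewrite -(@ler_pXn2r _ 2) ?nnegrE ?rnorm_ge0 ?ltW// rnorm_sqr.
  have hnm : (harmonic m : R) <= harmonic n by rewrite lef_pV2 ?posrE// ler_nat.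
  have := dE _ (VZ (2^-1) _ (VD _ _ (Vv n) (Vv m))).
  have [_] := hv n; have [_] := hv m; rewrite -!/(u _).
  have -> : z - (2^-1)%:C *: (v n + v m) = (2^-1)%:C *: (u n + u m).
    rewrite /u addrACA -opprD scalerBr; congr (_ - _).
    by rewrite half_add.
  have : (harmonic m : R) ^+ 2 <= harmonic n ^+ 2.
    by rewrite ler_pXn2r// nnegrE ltW.
  move: (u n) (u m) => x y; rewrite !rdotE (rdotC y x); lra.
have [p up] := complete_rnorm uu cvg_harmonic.
have pd : rdot p p <= d.
  apply: (@cvg_le (fun n => rdot (u n) (u n)) (fun n => d + harmonic n ^+ 2 / 4)).
  - exact: cvg_rdot2.
  - rewrite -[X in _ --> X]addr0; apply: cvgD; first exact: cvg_cst.
    rewrite -(mul0r 4^-1); apply: cvgMl.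
    under eq_fun do rewrite expr2.
    by rewrite -(mul0r (0 : R)); apply: cvgM; exact: cvg_harmonic.
  - by move=> n; case: (hv n) => _ /ltW.
have dp (t : R) w : V w -> d <= rdot (p - t%:C *: w) (p - t%:C *: w).
  move=> Vw.
  apply: (@cvg_le (cst d) (fun n => rdot (u n - t%:C *: w) (u n - t%:C *: w))).
  - exact: cvg_cst.
  - by apply: cvg_rdot2; apply: cvgB => //; exact: cvg_cst.
  - move=> n; rewrite /= /u -addrA -opprD; apply: dE.
    by apply: VD => //; exact: VZ.
have pperp w : V w -> rdot p w = 0.
  move=> Vw; have w0 := rdot_ge0 w.
  have h t : 0 <= t ^+ 2 * rdot w w - 2 * t * rdot p w.
    by have := dp t _ Vw; rewrite !rdotE (rdotC w p); lra.
  (* The minimizing [t] would have denominator [rdot w w], possibly zero; adding 1 still makes the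
     quadratic negative unless [rdot p w = 0]. *)
  have := h (rdot p w / (rdot w w + 1)).
  set c := rdot p w; set q := rdot w w; have q1 : 0 < q + 1 by rewrite /q; lra.
  have -> : (c / (q + 1)) ^+ 2 * q - 2 * (c / (q + 1)) * c =
      - (c ^+ 2 * (q + 2)) / (q + 1) ^+ 2 by field; lra.
  rewrite mulNr oppr_ge0 pmulr_lle0 ?invr_gt0 ?exprn_gt0// pmulr_lle0; last by lra.
  by move=> c0; apply/eqP; rewrite -sqrf_eq0 eq_le c0 sqr_ge0.
(* [p] is the limit of [z - v n] and is orthogonal to [z] and to each [v n], hence to itself. *)
have p0 : p = 0.
  apply: rdot_eq0; apply: (cvg_le (cvg_rdotr (z := p) up) (cvg_cst 0)) => n.
  by rewrite /u rdotDr rdotNr Vperp// pperp// subr0.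
move=> e e0; move: up; rewrite p0 => /cvg_rnorm/cvgr0Pnorm_lt/(_ _ e0)[N _ /(_ N (leqnn N))].
by rewrite /= subr0 ger0_norm ?rnorm_ge0//; exists (v N).
Qed.

(** * Square root of [1 - P] by successive approximation *)

Section SquareRoot.
Variables (U : hilbertType R) (P : U -> U).
Hypotheses (lP : linear P) (sP : rsym P) (P1 : forall x, rnorm (P x) <= rnorm x).

(* Approximations of [1 - sqrt (1 - P)]: the operator iterates are dominated in
   norm by the scalar iterates obtained for [P = 1]. *)
Fixpoint sqrt_it n (x : U) : U :=
  if n is m.+1 then (2^-1)%:C *: (P x + sqrt_it m (sqrt_it m x)) else 0.

Fixpoint sqrt_bound n : R := if n is m.+1 then (1 + sqrt_bound m ^+ 2) / 2 else 0.

Lemma sqrt_bound01 n : 0 <= sqrt_bound n <= 1.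
Proof. by elim: n => [|n /andP[h0 h1]] /=; [rewrite lexx ler01|apply/andP; split; nra]. Qed.

Lemma sqrt_bound_nd : {homo sqrt_bound : n m / (n <= m)%N >-> n <= m}.
Proof.
apply/nondecreasing_seqP => n /=; have := sqr_ge0 (1 - sqrt_bound n); lra.
Qed.

(** The iterates inherit from [P] linearity, symmetry and, with constant [sqrt_bound n], the norm
    bound. *)
Lemma sqrt_it_linear n : linear (sqrt_it n).
Proof.
elim: n => [|n ih] a x y /=; first by rewrite scaler0 addr0.
rewrite lP !ih [a *: (_ *: _)]scalerA [a * _]mulrC -scalerA -scalerDr; congr (_ *: _).
by rewrite scalerDr addrACA.
Qed.

Lemma sqrt_it_sym n : rsym (sqrt_it n).
Proof. by elim: n => [|n ih] x y /=; rewrite ?rdotE// sP !ih. Qed.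

Lemma sqrt_it_bound n x : rnorm (sqrt_it n x) <= sqrt_bound n * rnorm x.
Proof.
elim: n x => [|n ih] x /=; first by rewrite rnorm0 mul0r.
rewrite rnormZ ger0_norm//.
have := rnormD (P x) (sqrt_it n (sqrt_it n x)); have := P1 x.
have /andP[s0 s1] := sqrt_bound01 n.
have := ler_wpM2l s0 (ih x); have := ih (sqrt_it n x); lra.
Qed.

(** With [Y] and [Y'] two consecutive iterates, the next step is half of [Y' (Y' - Y) + (Y' - Y) Y],
    bounded just as the scalars [s'^2 - s^2 = (s' + s) (s' - s)]. *)
Lemma sqrt_it_step n x :
  rnorm (sqrt_it n.+1 x - sqrt_it n x) <= (sqrt_bound n.+1 - sqrt_bound n) * rnorm x.
Proof.
elim: n x => [|n ih] x.
  by rewrite /= subr0 addr0 subr0 expr0n/= addr0 rnormZ ger0_norm// mul1r ler_wpM2l.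
have -> : sqrt_it n.+2 x - sqrt_it n.+1 x = (2^-1)%:C *:
    (sqrt_it n.+1 (sqrt_it n.+1 x - sqrt_it n x) +
     (sqrt_it n.+1 (sqrt_it n x) - sqrt_it n (sqrt_it n x))).
  rewrite (lin_sub (@sqrt_it_linear n.+1)).
  rewrite addrA subrK [LHS]/= -scalerBr; congr (_ *: _).
  by rewrite opprD addrACA subrr add0r.
rewrite rnormZ ger0_norm//.
have := rnormD (sqrt_it n.+1 (sqrt_it n.+1 x - sqrt_it n x))
     (sqrt_it n.+1 (sqrt_it n x) - sqrt_it n (sqrt_it n x)).
have := sqrt_it_bound n.+1 (sqrt_it n.+1 x - sqrt_it n x).
have := ih (sqrt_it n x).
have /andP[s0 _] := sqrt_bound01 n.+1.
have d0 : 0 <= sqrt_bound n.+1 - sqrt_bound n by rewrite subr_ge0 sqrt_bound_nd.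
have := ler_wpM2l d0 (sqrt_it_bound n x); have := ler_wpM2l s0 (ih x).
rewrite [sqrt_bound n.+2]/=.
have -> : (1 + sqrt_bound n.+1 ^+ 2) / 2 - sqrt_bound n.+1 =
  ((sqrt_bound n.+1 + sqrt_bound n) * (sqrt_bound n.+1 - sqrt_bound n)) / 2.
  by rewrite /=; field.
lra.
Qed.

Lemma sqrt_it_cauchy n m x : (n <= m)%N ->
  rnorm (sqrt_it m x - sqrt_it n x) <= (sqrt_bound m - sqrt_bound n) * rnorm x.
Proof.
move=> /subnK <-; elim: (m - n)%N => [|k ih]; first by rewrite !subrr rnorm0 mul0r.
have := sqrt_it_step (k + n) x.
have := rnormD (sqrt_it (k + n).+1 x - sqrt_it (k + n) x) (sqrt_it (k + n) x - sqrt_it n x).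
rewrite addrA subrK addSn; lra.
Qed.

Lemma sqrt_bound_cvg : sqrt_bound @ \oo --> limn sqrt_bound.
Proof.
apply: nondecreasing_is_cvgn; first exact: sqrt_bound_nd.
by exists 1 => _ [n _ <-]; case/andP: (sqrt_bound01 n).
Qed.

(** The pointwise limit [Y] of the iterates is a symmetric contraction with [2 Y = P + Y^2], so
    [S = 1 - Y] is nonnegative with square [1 - P]. Whatever commutes with [P] commutes with every
    iterate, hence with [Y]. *)
Lemma sqrt_one_sub_ex : exists S : U -> U,
  [/\ nonnegative S, forall x, S (S x) = x - P x &
      forall T : U -> U, bounded_op T -> (forall x, T (P x) = P (T x)) ->
        forall x, T (S x) = S (T x)].
Proof.
have /choice[Y hY] (x : U) : exists l : U, sqrt_it ^~ x @ \oo --> l.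
  apply: (@complete_rnorm _ _ _ (fun n => (limn sqrt_bound - sqrt_bound n) * rnorm x)).
    move=> n m nm; apply: le_trans (sqrt_it_cauchy _ nm) _.
    rewrite ler_wpM2r ?rnorm_ge0// lerD2r.
    apply: nondecreasing_cvgn_le; first exact: sqrt_bound_nd.
    exact: sqrt_bound_cvg.
  rewrite -(mul0r (rnorm x)); apply: cvgMl; rewrite -(subrr (limn sqrt_bound)).
  by apply: cvgB; [exact: cvg_cst|exact: sqrt_bound_cvg].
have uniq (u : nat -> U) (a b : U) : u @ \oo --> a -> u @ \oo --> b -> a = b.
  by move=> ua ub; apply: (@cvg_unique _ _ _ _ _ _ ua ub).
have lY : linear Y.
  move=> a x y; apply: (uniq _ _ _ (hY _)).
  under eq_fun do rewrite sqrt_it_linear.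
  by apply: cvgD; [apply: cvgZ; [exact: cvg_cst|exact: hY]|exact: hY].
have sY : rsym Y.
  move=> x y; have h : rdot (sqrt_it n x) y @[n --> \oo] --> rdot x (Y y).
    by under eq_fun do rewrite sqrt_it_sym; exact: cvg_rdotr.
  exact: (@cvg_unique _ _ _ _ _ _ (cvg_rdotl (hY x)) h).
have it1 n x : rnorm (sqrt_it n x) <= rnorm x.
  apply: le_trans (sqrt_it_bound _ _) _.
  by rewrite ler_piMl ?rnorm_ge0//; case/andP: (sqrt_bound01 n).
have Y1 x : rnorm (Y x) <= rnorm x.
  apply: (cvg_le (cvg_rnorm_lim (hY x)) (cvg_cst (rnorm x))) => n.
  exact: it1.
have YY x : (2^-1)%:C *: (P x + Y (Y x)) = Y x.
  have h1 : sqrt_it n.+1 x @[n --> \oo] --> Y x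
    by rewrite (cvg_shiftS (sqrt_it ^~ x)).
  apply: esym; apply: (uniq _ _ _ h1) => /=.
  apply: cvgZ; first exact: cvg_cst.
  apply: cvgD; first exact: cvg_cst.
  (* The operator and its argument vary together; since the iterates are contractions, the error of
     the argument passes through them. *)
  apply: (@cvg_rnorm_le _ _ _ _ (fun n => rnorm (sqrt_it n x - Y x) +
      rnorm (sqrt_it n (Y x) - Y (Y x)))).
    move=> n; rewrite -(subrK (sqrt_it n (Y x)) (sqrt_it n (sqrt_it n x))) -addrA.
    apply: le_trans (rnormD _ _) _; rewrite lerD2r -lin_sub//.
    exact: sqrt_it_linear.
  by rewrite -[0](addr0 (0 : R)); apply: cvgD; apply/cvg_rnorm; exact: hY.
exists (fun x => x - Y x); split.
- apply: nonnegativeI.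
  + by apply: bounded_opB (bounded_op_id _) (bounded_op_rnorm (c := 1) lY _) => x; rewrite mul1r.
  + by move=> x y; rewrite !rdotE sY.
  + move=> x; rewrite rdotDl rdotNl subr_ge0 -rnorm_sqr.
    by apply: le_trans (rdot_le _ _) _; rewrite expr2 ler_wpM2r ?rnorm_ge0.
- move=> x; rewrite (lin_sub lY) opprB addrA.
  have := congr1 (fun z => z + z) (YY x).
  rewrite -scalerDr half_add => YYE.
  have -> : Y (Y x) = Y x + Y x - P x by rewrite -YYE addrC addKr.
  by rewrite !addrA subrK [_ - P x - _]addrAC addrK.
- move=> T [lT cT] TP x; rewrite lin_sub//; congr (_ - _).
  have Tit n y : T (sqrt_it n y) = sqrt_it n (T y).
    elim: n y => [|n ih] y /=; first by rewrite lin0.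
    by rewrite lin_scale// lin_add// TP !ih.
  apply: (uniq (fun n => T (sqrt_it n x))); last by under eq_fun do rewrite Tit; exact: hY.
  exact: (cvg_comp _ _ (hY x) (cT (Y x))).
Qed.

End SquareRoot.

(** Rescaling: for [d] above the norm of [A], [P = 1 - A / d] is a contraction, and the root of
    [1 - P] times the root of [d] is the root of [A]. *)
Lemma op_sqrt_ex U (A : U -> U) (c : R) : nonnegative A ->
  (forall x, rnorm (A x) <= c * rnorm x) -> is_op_sqrt A (op_sqrt A).
Proof.
move=> nA cA; have [[lA _] _] := nA; have sA := nonnegative_sym nA.
pose d := `|c| + 1; have d0 : 0 < d by rewrite /d; have := normr_ge0 c; lra.
have dA x : rnorm (A x) <= d * rnorm x.
  by apply: le_trans (cA x) _; rewrite ler_wpM2r ?rnorm_ge0// /d; have := ler_norm c; lra.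
pose P x := x - (d^-1)%:C *: A x.
have lP : linear P.
  move=> a x y; rewrite /P lA scalerDr opprD addrACA scalerBr; congr (_ - _ + _).
  by rewrite !scalerA mulrC.
have sP : rsym P by move=> x y; rewrite /P !rdotE sA.
(* Positivity of the form of [A] at [x - A x / d] gives [|A x|^2 <= d (A x, x)]. *)
have AA x : rdot (A x) (A x) <= d * rdot (A x) x.
  have := nonnegative_ge0 nA (x - (d^-1)%:C *: A x).
  rewrite lin_sub// lin_scale// !rdotE (sA (A x) x).
  have : rdot (A (A x)) (A x) <= d * rdot (A x) (A x).
    apply: le_trans (rdot_le _ _) _; rewrite -rnorm_sqr expr2 mulrA.
    by rewrite ler_wpM2r ?rnorm_ge0.
  set p := rdot (A (A x)) (A x); set q := rdot (A x) (A x); set r := rdot (A x) x.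
  move=> pq h.
  have : 0 <= d * (r - d^-1 * q - d^-1 * (q - d^-1 * p)).
    by apply: mulr_ge0; [exact: ltW|lra].
  have -> : d * (r - d^-1 * q - d^-1 * (q - d^-1 * p)) = d * r - 2 * q + p / d.
    by field; rewrite gt_eqF.
  have : p / d <= q by rewrite ler_pdivrMr// mulrC.
  lra.
have P1 x : rnorm (P x) <= rnorm x.
  rewrite rnorm_le /P !rdotE (rdotC x (A x)).
  have : 0 <= d^-1 ^+ 2 * (d * rdot (A x) x - rdot (A x) (A x)).
    by rewrite mulr_ge0 ?sqr_ge0// subr_ge0.
  have : 0 <= d^-1 * rdot (A x) x.
    by rewrite mulr_ge0 ?invr_ge0 ?(ltW d0)//; exact: nonnegative_ge0.
  have -> : d^-1 ^+ 2 * (d * rdot (A x) x - rdot (A x) (A x)) =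
    d^-1 * rdot (A x) x - d^-1 * (d^-1 * rdot (A x) (A x)).
    by field; rewrite gt_eqF.
  lra.
have [S [nS SS _]] := sqrt_one_sub_ex lP sP P1.
have [bS _] := nS.
apply: (@xgetPex _ (cst 0) (is_op_sqrt A)).
exists ((Num.sqrt d)%:C \*: S); split.
  apply: nonnegativeI; first exact: bounded_opZ.
    by move=> x y /=; rewrite !rdotE nonnegative_sym.
  by move=> x /=; rewrite rdotZl mulr_ge0 ?sqrtr_ge0//; exact: nonnegative_ge0.
apply/funext => x /=; rewrite (lin_scale bS.1) SS /P scalerA -rmorphM -expr2 sqr_sqrtr ?ltW//.
by rewrite opprB addrC subrK scalerA -rmorphM mulfV ?gt_eqF// scale1r.
Qed.

End Completeness.

(** * Shorted operators of block operators *)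

Section ShortedOperators.
Context {R : realType}.
Implicit Types U V K H G : hilbertType R.

Lemma op_le_rdot U (S T : U -> U) : op_le S T -> forall x, rdot (S x) x <= rdot (T x) x.
Proof. by move=> ST x; have := ST x; rewrite lecE => /andP[]. Qed.

(** Two maxima dominate each other, so their forms agree and [xget] can only return [Z]. *)
Lemma shorted_eq U (S : U -> U) (M : set U) Z : is_shorted S M Z -> shorted S M = Z.
Proof.
move=> [bZ mZ]; apply: xget_unique => // Z' [bZ' mZ'].
have [nZ _ _] := bZ; have [nZ' _ _] := bZ'.
apply: eq_op_form; [exact: nZ'.1.1|exact: nonnegative_sym|exact: nZ.1.1|exact: nonnegative_sym|].
by move=> x; apply/eqP; rewrite eq_le !op_le_rdot//; [exact: mZ'|exact: mZ].
Qed.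

(** Add the upper bound at [x + X x] to the lower bound at [x - X x]: the form of [X] cancels at [x]
    and at [X x]. *)
Lemma contractive_form U (X : U -> U) : linear X -> rsym X ->
  (forall x, - rdot x x <= rdot (X x) x <= rdot x x) ->
  forall x, rnorm (X x) <= rnorm x.
Proof.
move=> lX sX hX x; rewrite rnorm_le.
have /andP[_] := hX (x + X x); have /andP[+ _] := hX (x - X x).
rewrite !(lin_add lX) (lin_opp lX) !rdotE (sX (X x) x) (rdotC x (X x)); lra.
Qed.

Lemma rdot_hsum K H (x y : hsum K H) : rdot x y = rdot x.1 y.1 + rdot x.2 y.2.
Proof. by rewrite /rdot -raddfD. Qed.

Lemma bounded_op_fst K H : bounded_op (fst : hsum K H -> K).
Proof.
apply: (bounded_op_rnorm (c := 1)) => // x.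
by rewrite mul1r -lecR !rnormE hsum_norm_fst.
Qed.

Lemma bounded_op_snd K H : bounded_op (snd : hsum K H -> H).
Proof.
apply: (bounded_op_rnorm (c := 1)) => // x.
by rewrite mul1r -lecR !rnormE hsum_norm_snd.
Qed.

Lemma bounded_op_inl K H : bounded_op (fun k => (k, 0) : hsum K H).
Proof.
apply: (bounded_op_rnorm (c := 1)) => [a x y|x].
  by congr pair; rewrite /= scaler0 addr0.
by rewrite mul1r -(@ler_pXn2r _ 2) ?nnegrE ?rnorm_ge0// !rnorm_sqr rdot_hsum/= rdot0l addr0.
Qed.

Lemma bounded_op_inr K H : bounded_op (fun h => (0, h) : hsum K H).
Proof.
apply: (bounded_op_rnorm (c := 1)) => [a x y|x].
  by congr pair; rewrite /= scaler0 addr0.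
by rewrite mul1r -(@ler_pXn2r _ 2) ?nnegrE ?rnorm_ge0// !rnorm_sqr rdot_hsum/= rdot0l add0r.
Qed.

Lemma bounded_block_op K H (X11 : K -> K) (X12 : H -> K) (X21 : K -> H) (X22 : H -> H) :
  bounded_op X11 -> bounded_op X12 -> bounded_op X21 -> bounded_op X22 ->
  bounded_op (block_op X11 X12 X21 X22).
Proof.
move=> b11 b12 b21 b22.
have b1 := bounded_opD (bounded_op_comp b11 (@bounded_op_fst K H))
  (bounded_op_comp b12 (@bounded_op_snd K H)).
have b2 := bounded_opD (bounded_op_comp b21 (@bounded_op_fst K H))
  (bounded_op_comp b22 (@bounded_op_snd K H)).
have := bounded_opD (bounded_op_comp (@bounded_op_inl K H) b1)
  (bounded_op_comp (@bounded_op_inr K H) b2).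
by congr bounded_op; apply/funext => x; congr pair; rewrite /= ?addr0 ?add0r.
Qed.

Lemma rsym_block_op K H (X11 : K -> K) (X12 : H -> K) (X21 : K -> H) (X22 : H -> H) :
  rsym X11 -> rsym X22 -> (forall h k, rdot (X12 h) k = rdot h (X21 k)) ->
  rsym (block_op X11 X12 X21 X22).
Proof.
move=> s11 s22 s12 x y; rewrite !rdot_hsum/= !rdotE s11 s22 s12.
by rewrite -(rdotC (X12 y.2)) s12 (rdotC _ y.2); ring.
Qed.

(** Lets the form of a competitor [W] be evaluated where the form dominating it is small. *)
Lemma rdot_shift U (W : U -> U) f g : linear W -> rsym W -> W g = 0 ->
  rdot (W (f + g)) (f + g) = rdot (W f) f.
Proof. by move=> lW sW Wg; rewrite (lin_add lW) Wg addr0 rdotDr (sW f g) Wg rdot0r addr0. Qed.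

(** * Shorted operators of a block operator with identity corner *)

Section Block.
Variables (K H : hilbertType R) (A : K -> K) (D : H -> K) (D' : K -> H).
Hypotheses (nA : nonnegative A) (bD : bounded_op D) (bD' : bounded_op D').
Hypothesis DD' : forall h k, rdot (D h) k = rdot h (D' k).

(* The block operator whose Schur complement on [K] is [A]. *)
Definition schur_block := block_op (A \+ (D \o D')) D D' (idfun : H -> H).

(** Completion of the square in the second component. *)
Lemma schur_block_form x :
  rdot (schur_block x) x = rdot (A x.1) x.1 + rdot (x.2 + D' x.1) (x.2 + D' x.1).
Proof.
rewrite rdot_hsum/= !rdotE !DD' (rdotC (D' x.1) x.2); ring.
Qed.

Lemma schur_block_nonneg : nonnegative schur_block.
Proof.
apply: nonnegativeI.
- apply: bounded_block_op => //; last exact: bounded_op_id.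
  by apply: bounded_opD; [case: nA|exact: bounded_op_comp].
- apply: rsym_block_op => // x y /=.
  rewrite !rdotE (nonnegative_sym nA) DD'; congr (_ + _).
  by rewrite (rdotC x) DD' rdotC.
- by move=> x; rewrite schur_block_form addr_ge0 ?rdot_ge0//; exact: nonnegative_ge0.
Qed.

(** A competitor has range in [summand1], so by symmetry it kills [summand2]; its form at [(k, h)]
    is that at [(k, - D' k)], where the square vanishes and [A] alone remains. *)
Lemma shorted_schur_block1 : shorted schur_block (summand1 K H) = fun x => (A x.1, 0).
Proof.
have [bA _] := nA; have sA := nonnegative_sym nA.
have [[lS _] _] := schur_block_nonneg; have sS := nonnegative_sym schur_block_nonneg.
pose Z (x : hsum K H) : hsum K H := (A x.1, 0).
have bZ : bounded_op Z.
  exact: bounded_op_comp (@bounded_op_inl K H) (bounded_op_comp bA (@bounded_op_fst K H)).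
have sZ : rsym Z by move=> x y; rewrite !rdot_hsum/= !rdotE sA.
have Zform x : rdot (Z x) x = rdot (A x.1) x.1 by rewrite rdot_hsum/= rdot0l addr0.
have nZ : nonnegative Z.
  by apply: nonnegativeI => // x; rewrite Zform; exact: nonnegative_ge0.
apply: shorted_eq; split.
  split=> //; last by move=> _ [x _ <-].
  apply/(op_leP nZ.1.1 sZ lS sS) => x.
  by rewrite Zform schur_block_form lerDl rdot_ge0.
move=> W [nW WS WM]; have [[lW _] _] := nW; have sW := nonnegative_sym nW.
have W0 h : W (0, h) = 0.
  apply: rdot_nondeg => g; rewrite sW rdot_hsum/= rdot0l add0r rdot0l.
  by rewrite (_ : (W g).2 = 0) ?rdot0r//; apply: WM; exists g.
apply/(op_leP lW sW nZ.1.1 sZ) => -[k h]; rewrite Zform.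
have -> : ((k, h) : hsum K H) = (k, - D' k) + (0, h + D' k).
  by congr pair; rewrite /= ?addr0// addrC addrK.
rewrite rdot_shift//; apply: le_trans (op_le_rdot WS _) _.
by rewrite schur_block_form/= addNr rdot0l !addr0.
Qed.

(** A competitor kills [summand1], so its form at [(k, h)] is at most [|T' k'|^2 + |h - D' k'|^2]
    for every [k']; this is arbitrarily small once the pairs [(D' k', T' k')] approximate
    [(h, 0)]. *)
Lemma shorted_schur_block2 G (T : G -> K) (T' : K -> G) : linear T ->
  (forall g k, rdot (T g) k = rdot g (T' k)) -> (forall k, A k = T (T' k)) ->
  (forall h g, D h = T g -> h = 0) ->
  shorted schur_block (summand2 K H) = cst 0.
Proof.
move=> lT TT' AT DT; have lT' := linear_adjoint lT TT'.
have [[lS _] _] := schur_block_nonneg; have sS := nonnegative_sym schur_block_nonneg.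
have n0 : nonnegative (cst 0 : hsum K H -> hsum K H).
  apply: nonnegativeI; [exact: bounded_op0|exact: rsym_cst0|].
  by move=> x; rewrite rdot0l.
apply: shorted_eq; split.
  split=> //; last by move=> _ [x _ <-].
  apply/(op_leP n0.1.1 (@rsym_cst0 _ _) lS sS) => x.
  by rewrite rdot0l; exact: nonnegative_ge0 schur_block_nonneg _.
move=> W [nW WS WM]; have [[lW _] _] := nW; have sW := nonnegative_sym nW.
have W0 k : W (k, 0) = 0.
  apply: rdot_nondeg => g; rewrite sW rdot_hsum/= rdot0l addr0 rdot0l.
  by rewrite (_ : (W g).1 = 0) ?rdot0r//; apply: WM; exists g.
apply/(op_leP lW sW n0.1.1 (@rsym_cst0 _ _)) => -[k h]; rewrite rdot0l.
apply/ler_addgt0Pr => e e0; rewrite add0r.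
have s0 : 0 < Num.sqrt e by rewrite sqrtr_gt0.
have [||||v [k' _ <-]] := @dense_of_orthogonal _ (hsum H G)
   (range (fun k => (D' k, T' k) : hsum H G)) (h, 0) _ _ _ _ _ s0.
- by exists 0 => //; rewrite (lin0 bD'.1) (lin0 lT').
- move=> _ _ [x _ <-] [y _ <-]; exists (x + y) => //.
  by rewrite (lin_add bD'.1) (lin_add lT').
- move=> a _ [x _ <-]; exists (a%:C *: x) => //.
  by rewrite (lin_scale bD'.1) (lin_scale lT').
(* Orthogonality of [(a, b)] to all these pairs says [D a + T b = 0], so that [D a] lies in both
   ranges. *)
- move=> [a b] perp; rewrite rdot_hsum/= rdot0r addr0.
  suff -> : a = 0 by rewrite rdot0l.
  apply: (DT _ (- b)); rewrite (lin_opp lT); apply/eqP.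
  rewrite -subr_eq0 opprK; apply/eqP/rdot_eq0; set z := (X in rdot X X).
  rewrite {1}/z rdotDl DD' TT'.
  by have := perp _ (ex_intro2 _ _ z I erefl); rewrite rdot_hsum/= => ->.
move=> hv; have -> : ((k, h) : hsum K H) = (- k', h) + (k + k', 0).
  by congr pair; rewrite /= ?addr0// addrC addrK.
rewrite rdot_shift//; apply: le_trans (op_le_rdot WS _) _.
rewrite schur_block_form/= (lin_opp bD'.1) AT !(lin_opp lT') (lin_opp lT) rdotNl rdotNr opprK TT'.
have : rnorm ((h, 0) - (D' k', T' k') : hsum H G) ^+ 2 < Num.sqrt e ^+ 2.
  by rewrite ltr_pXn2r// nnegrE ?rnorm_ge0 ?sqrtr_ge0.
rewrite sqr_sqrtr ?(ltW e0)// rnorm_sqr rdot_hsum/= sub0r !rdotE; lra.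
Qed.

End Block.

(** * Contractions with zero corner and factored Schur complements *)

Section Contraction.
Variables (K H G : hilbertType R) (X11 : K -> K) (D : H -> K) (D' : K -> H).
Variables (T1 T2 : G -> K) (T1' T2' : K -> G).
Hypotheses (b11 : bounded_op X11) (s11 : rsym X11).
Hypotheses (bD : bounded_op D) (bD' : bounded_op D').
Hypothesis DD' : forall h k, rdot (D h) k = rdot h (D' k).
Hypotheses (lT1 : linear T1) (lT2 : linear T2).
Hypothesis TT1 : forall g k, rdot (T1 g) k = rdot g (T1' k).
Hypothesis TT2 : forall g k, rdot (T2 g) k = rdot g (T2' k).
Hypothesis A1 : forall k, k + X11 k - D (D' k) = T1 (T1' k).
Hypothesis A2 : forall k, k - X11 k - D (D' k) = T2 (T2' k).
Hypothesis DT1 : forall h g, D h = T1 g -> h = 0.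
Hypothesis DT2 : forall h g, D h = T2 g -> h = 0.

Let X : hsum K H -> hsum K H := block_op X11 D (adjoint D) (cst 0).

Let adjD : adjoint D = D'. Proof. exact: adjoint_eq bD.1 bD' DD'. Qed.

Let nonnegative_TT (T : G -> K) T' A : linear T -> bounded_op A ->
  (forall g k, rdot (T g) k = rdot g (T' k)) -> (forall k, A k = T (T' k)) -> nonnegative A.
Proof.
move=> lT bA TT' AT; apply: nonnegativeI => // [x y|x].
  by rewrite !AT TT' -(rdotC (T _)) TT' rdotC.
by rewrite AT TT' rdot_ge0.
Qed.

Let bDD : bounded_op (D \o D'). Proof. exact: bounded_op_comp. Qed.

Let nA1 : nonnegative (idfun \+ X11 \- (D \o D')).
Proof.
apply: (nonnegative_TT lT1 _ TT1) => //.
by apply: bounded_opB => //; apply: bounded_opD => //; exact: bounded_op_id.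
Qed.

Let nA2 : nonnegative (idfun \- X11 \- (D \o D')).
Proof.
apply: (nonnegative_TT lT2 _ TT2) => //.
by apply: bounded_opB => //; apply: bounded_opB => //; exact: bounded_op_id.
Qed.

Let XE1 : idfun \+ X = schur_block (idfun \+ X11 \- (D \o D')) D D'.
Proof.
apply/funext => x; rewrite /X adjD; congr pair; first by rewrite /= subrK addrA.
by rewrite /= addr0 addrC.
Qed.

(** The off-diagonal entries of [I - X] carry the opposite sign. *)
Let ND := (-1 : R[i]) \*: D.
Let ND' := (-1 : R[i]) \*: D'.

Let NDD h k : rdot (ND h) k = rdot h (ND' k).
Proof. by rewrite /ND /ND' /= !scaleN1r rdotNl rdotNr DD'. Qed.

Let XE2 : idfun \- X = schur_block (idfun \- X11 \- (D \o D')) ND ND'.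
Proof.
apply/funext => x; rewrite /X adjD /ND /ND'; congr pair.
  by rewrite /= !scaleN1r (lin_opp bD.1) opprK subrK opprD addrA.
by rewrite /= scaleN1r addr0 addrC.
Qed.

(** [I + X] and [I - X] are both Schur blocks. Their nonnegativity bounds the form of [X] on both
    sides, and their Schur complements are [I + Zhat0 X] and [I - Zhat1 X]. *)
Lemma shorted_contraction :
  [/\ selfadjoint X /\ contractive X,
      shorted (idfun \- X) (summand2 K H) = cst 0 /\
      shorted (idfun \+ X) (summand2 K H) = cst 0,
      forall k, Zhat0 X k = X11 k - D (D' k) &
      forall k, Zhat1 X k = X11 k + D (D' k)].
Proof.
have bND : bounded_op ND by exact: bounded_opZ.
have bND' : bounded_op ND' by exact: bounded_opZ.
have bX : bounded_op X.
  by rewrite /X adjD; apply: bounded_block_op => //; exact: bounded_op0.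
have sX : rsym X.
  by rewrite /X adjD; apply: rsym_block_op => //; exact: rsym_cst0.
split.
- split; first exact/selfadjointP.
  split=> // x; rewrite -!rnormE lecR; apply: contractive_form => //; first exact: bX.1.
  move=> {}x; have := nonnegative_ge0 (schur_block_nonneg nA1 bD bD' DD') x.
  have := nonnegative_ge0 (schur_block_nonneg nA2 bND bND' NDD) x.
  rewrite -XE1 -XE2 /= !rdotE; lra.
- split.
    rewrite XE2; apply: (shorted_schur_block2 nA2 bND bND' NDD lT2 TT2) => // h g.
    by rewrite /ND/= scaleN1r => /(canRL (@opprK _)); rewrite -(lin_opp lT2); exact: DT2.
  by rewrite XE1; exact: (shorted_schur_block2 nA1 bD bD' DD' lT1 TT1).
- move=> k; rewrite /Zhat0 /restrict1 XE1 shorted_schur_block1//=.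
  by rewrite addrC addrA addKr.
- move=> k; rewrite /Zhat1 /restrict1 XE2 shorted_schur_block1//=.
  by rewrite !opprB addrC addrA subrK addrC.
Qed.

End Contraction.

End ShortedOperators.

(** * Orthonormal sequences *)

Section OrthonormalSequences.
Context {R : realType}.
Implicit Types K H : hilbertType R.

Definition sqn (c : R[i]) : R := complex.Re c ^+ 2 + complex.Im c ^+ 2.

Lemma sqn_ge0 c : 0 <= sqn c.
Proof. by rewrite addr_ge0 ?sqr_ge0. Qed.

Lemma sqn_eq0 c : sqn c <= 0 -> c = 0.
Proof.
case: c => a b; rewrite /sqn/= => h; have := sqr_ge0 a; have := sqr_ge0 b => b0 a0.
have /eqP : a ^+ 2 = 0 by lra.
have /eqP : b ^+ 2 = 0 by lra.
by rewrite !sqrf_eq0 => /eqP -> /eqP ->.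
Qed.

Lemma sqnM a b : sqn (a * b) = sqn a * sqn b.
Proof. by case: a b => [a1 a2] [b1 b2]; rewrite /sqn/=; ring. Qed.

Lemma sqn_real (a : R) : sqn a%:C = a ^+ 2.
Proof. by rewrite /sqn/= expr0n addr0. Qed.

Lemma sqnN a : sqn (- a) = sqn a.
Proof. by case: a => a b; rewrite /sqn/= !sqrrN. Qed.

Lemma sqn_conj a : sqn (conjC a) = sqn a.
Proof. by case: a => a b; rewrite /sqn/= sqrrN. Qed.

Lemma sqnB_le a b : sqn (a - b) <= 2 * (sqn a + sqn b).
Proof.
case: a b => [a1 a2] [b1 b2]; rewrite /sqn/=.
have := sqr_ge0 (a1 + b1); have := sqr_ge0 (a2 + b2); lra.
Qed.

Lemma rdot_scale2 H c (x : H) : rdot (c *: x) (c *: x) = sqn c * rdot x x.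
Proof.
by rewrite /rdot hdotZl linearZr_LR/= hdotxx; case: c => a b; rewrite /sqn/=; ring.
Qed.

(** Multiplying [x] by the conjugate of [c] makes the product with [y] equal to [sqn c]; the real
    Cauchy-Schwarz inequality applies. *)
Lemma sqn_hdot H (x y : H) : sqn (hdot x y) <= rdot x x * rdot y y.
Proof.
set c := hdot x y.
have h : rdot (conjC c *: x) y = sqn c.
  by rewrite /rdot hdotZl -/c; case: c => a b; rewrite /sqn/=; ring.
have := ler_norm_rdot (conjC c *: x) y.
rewrite h ger0_norm ?sqn_ge0// -(@ler_pXn2r _ 2) ?nnegrE ?sqn_ge0 ?mulr_ge0 ?rnorm_ge0//.
rewrite exprMn !rnorm_sqr rdot_scale2 sqn_conj expr2 -mulrA.
have := sqn_ge0 c; rewrite le_eqVlt => /predU1P[<- _|c0]; first by rewrite mulr_ge0 ?rdot_ge0.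
by rewrite ler_pM2l.
Qed.

Definition orthonormal_seq H (e : nat -> H) :=
  forall i j, hdot (e i) (e j) = (i == j)%:R.

Definition hilbert_basis H (e : nat -> H) :=
  orthonormal_seq e /\ forall x, (forall n, hdot x (e n) = 0) -> x = 0.

(** Basis vectors lie more than 1 apart, so picking a point of the countable dense set within 1/2 of
    each one is injective; hence the infinite basis is countable. *)
Lemma separable_hilbert_basis H : separable_space H -> hdim_infinite H ->
  exists e : nat -> H, hilbert_basis e.
Proof.
move=> [A [cA dA]] [B [[oB tB] iB]].
have /choice[g hg] (b : H) : exists a, A a /\ rnorm (b - a) < 2^-1.
  have h2 : 0 < (2^-1 : R)%:C by rewrite ltcR.
  have [a [ba Aa]] := dA (ball b (2^-1 : R)%:C) 
    (ex_intro _ b (ballxx _ h2)) (@ball_open _ _ b _).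
  by exists a; split=> //; move: ba; rewrite -ball_normE /ball_/= -rnormE ltcR.
have rB b b' : B b -> B b' -> rdot b b' = (b == b')%:R.
  by move=> Bb Bb'; rewrite /rdot oB//; case: (b == b').
have gI : {in B &, injective g}.
  move=> b b' /set_mem Bb /set_mem Bb' gb; apply: contrapT => /eqP bb'.
  have := (hg b).2; rewrite gb => h1; have h2 := (hg b').2.
  have : rnorm (b - b') < 1.
    have := rnormB (b - g b) (b' - g b'); rewrite gb opprB addrA subrK; lra.
  rewrite -(@ltr_pXn2r _ 2) ?nnegrE ?rnorm_ge0// rnorm_sqr !rdotE !rB// !eqxx.
  rewrite (eq_sym b') (negbTE bb')/=; lra.
have cB : countable B.
  have /countable_injP[f fI] := cA.
  apply/countable_injP; exists (f \o g) => b b' Bb Bb' /= /fI h; apply: gI => //.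
  by apply: h; apply/mem_set; exact: (hg _).1.
have : ([set: nat] #= B)%card by rewrite card_eq_sym; exact: eq_card_nat.
case/card_set_bijP => e [eB eI eS]; exists e; split.
  by move=> i j; rewrite oB; [|exact: eB|exact: eB]; congr (nat_of_bool _)%:R;
     apply/eqP/eqP => [/eI->|->]//; apply/mem_set.
by move=> x hx; apply: tB => b /eS[n _ <-]; exact: hx.
Qed.

(** * Fourier expansions along an orthonormal sequence *)

Section Fourier.
Variables (H : hilbertType R) (e : nat -> H).
Hypothesis oe : orthonormal_seq e.

Definition fourier_sum (c : nat -> R[i]) N : H := \sum_(i < N) c i *: e i.

Lemma hdot_fourier_sum c N n :
  hdot (fourier_sum c N) (e n) = if (n < N)%N then c n else 0.
Proof.
elim: N => [|N ih]; first by rewrite /fourier_sum big_ord0 linear0l.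
rewrite /fourier_sum big_ord_recr/= linearDl/= -/(fourier_sum c N) ih hdotZl oe ltnS.
by case: ltngtP => [nN|nN|->]; rewrite ?mulr0 ?addr0 ?mulr1 ?add0r.
Qed.

Lemma hdot0_rdotZ (x y : H) c : hdot x y = 0 -> rdot x (c *: y) = 0.
Proof. by move=> xy; rewrite /rdot linearZr_LR/= xy mulr0. Qed.

Lemma rdot_basis n : rdot (e n) (e n) = 1.
Proof. by rewrite /rdot oe eqxx. Qed.

Lemma rdot_fourier_sumB c n m : (n <= m)%N ->
  rdot (fourier_sum c m - fourier_sum c n) (fourier_sum c m - fourier_sum c n) =
  \sum_(i < m) sqn (c i) - \sum_(i < n) sqn (c i).
Proof.
move=> /subnK <-; elim: (m - n)%N => [|k ih]; first by rewrite !subrr rdot0l.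
rewrite addSn /fourier_sum !big_ord_recr/= -!/(fourier_sum _ _) addrAC.
have xe : rdot (fourier_sum c (k + n) - fourier_sum c n) (c (k + n)%N *: e (k + n)%N) = 0.
  apply: hdot0_rdotZ; rewrite linearBl/= !hdot_fourier_sum ltnn.
  by rewrite ltnNge leq_addl subrr.
move: (_ - _ : H) ih xe => x ih xe.
rewrite !rdotDl !rdotDr ih rdot_scale2 rdot_basis mulr1 (rdotC _ x) xe; ring.
Qed.

Lemma bessel x N : \sum_(i < N) sqn (hdot x (e i)) <= rdot x x.
Proof.
set c := fun i => hdot x (e i); pose s := fourier_sum c N.
have ss : rdot s s = \sum_(i < N) sqn (c i).
  by have := rdot_fourier_sumB c (leq0n N); rewrite /fourier_sum !big_ord0 !subr0.
have xs : rdot x s = \sum_(i < N) sqn (c i).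
  rewrite /s /fourier_sum; elim: (N) => [|n ih]; first by rewrite !big_ord0 rdot0r.
  rewrite !big_ord_recr/= rdotDr ih; congr (_ + _).
  rewrite /rdot linearZr_LR/= -/(c n); case: (c n) => a b; rewrite /sqn/=; ring.
have := rdot_ge0 (x - s); rewrite !rdotE (rdotC s x) ss xs -/(\sum_(i < N) sqn (c i)); lra.
Qed.

(** Squared distances of partial sums are increments of a bounded nondecreasing series, which makes
    the sums Cauchy. *)
Lemma riesz_fischer (c : nat -> R[i]) (B : R) : (forall N, \sum_(i < N) sqn (c i) <= B) ->
  exists x, [/\ fourier_sum c @ \oo --> x, forall n, hdot x (e n) = c n & rdot x x <= B].
Proof.
move=> cB; pose a n := \sum_(i < n) sqn (c i).
have a_nd : {homo a : n m / (n <= m)%N >-> n <= m}.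
  by apply/nondecreasing_seqP => n; rewrite /a big_ord_recr/= lerDl sqn_ge0.
have a_cvg : a @ \oo --> limn a.
  by apply: nondecreasing_is_cvgn => //; exists B => _ [n _ <-]; exact: cB.
have [x cx] : exists x : H, fourier_sum c @ \oo --> x.
  apply: (@complete_rnorm _ _ _ (fun n => Num.sqrt (limn a - a n))) => [n m nm|].
    rewrite -(@ler_pXn2r _ 2) ?nnegrE ?rnorm_ge0 ?sqrtr_ge0// rnorm_sqr.
    have aml : a m <= limn a by exact: nondecreasing_cvgn_le.
    rewrite rdot_fourier_sumB// sqr_sqrtr -?/(a _) ?lerD2r// subr_ge0.
    exact: le_trans (a_nd _ _ nm) aml.
  rewrite -[X in _ --> X](@sqrtr0 R) -(subrr (limn a)).
  apply: (cvg_comp _ Num.sqrt); last exact: sqrt_continuous.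
  by apply: cvgB => //; exact: cvg_cst.
have uniq (u : nat -> R) (l1 l2 : R) : u @ \oo --> l1 -> u @ \oo --> l2 -> l1 = l2.
  by move=> u1 u2; apply: (@cvg_unique _ _ _ _ _ _ u1 u2).
exists x; split=> // [n|].
  (* [rdot] sees real parts only; [w = 1] and [w = 'i] give both parts of the coefficient. *)
  have lim (w : R[i]) : rdot (w *: x) (e n) = complex.Re (w * c n).
    apply: (uniq (fun N => rdot (w *: fourier_sum c N) (e n))).
      by apply: cvg_rdotl; apply: cvgZ => //; exact: cvg_cst.
    apply/cvgrPdist_lt => eps eps0; exists n.+1 => // N /= nN.
    by rewrite /rdot hdotZl hdot_fourier_sum nN subrr normr0.
  apply/eqP; rewrite eq_complex Im_hdot -/(rdot _ _) lim.
  have := lim 1; rewrite scale1r mul1r => ->; rewrite eqxx/=.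
  by case: (c n) => u v /=; rewrite mul0r mul1r sub0r opprK.
apply: (cvg_le (cvg_rdot2 cx) (cvg_cst B)) => N; apply: le_trans (cB N).
by have := rdot_fourier_sumB c (leq0n N); rewrite /fourier_sum !big_ord0 !subr0 => ->.
Qed.

Hypothesis te : forall x, (forall n, hdot x (e n) = 0) -> x = 0.

Lemma eq_fourier x y : (forall n, hdot x (e n) = hdot y (e n)) -> x = y.
Proof.
move=> xy; apply/eqP; rewrite -subr_eq0; apply/eqP/te => n.
by rewrite linearBl/= xy subrr.
Qed.

Lemma fourier_cvg x : fourier_sum (fun i => hdot x (e i)) @ \oo --> x.
Proof.
have [y [cy hy _]] := @riesz_fischer (fun i => hdot x (e i)) _ (bessel x).
by rewrite -{2}(@eq_fourier y x).
Qed.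

Lemma rdot_le_fourier x B : (forall N, \sum_(i < N) sqn (hdot x (e i)) <= B) ->
  rdot x x <= B.
Proof. by move=> /(@riesz_fischer (fun i => hdot x (e i)))[y [_ /eq_fourier -> ]]. Qed.

Lemma rdot_fourier_disjoint x y :
  (forall n, hdot x (e n) = 0 \/ hdot y (e n) = 0) -> rdot x y = 0.
Proof.
move=> xy; have h := cvg_rdotr (z := x) (@fourier_cvg y).
apply: (@cvg_unique _ _ _ _ _ _ h) => //.
apply/cvgrPdist_lt => eps eps0; exists 0%N => // N _.
rewrite (_ : rdot _ _ = 0) ?subrr ?normr0// /fourier_sum.
elim: N => [|N ih]; first by rewrite big_ord0 rdot0r.
rewrite big_ord_recr/= rdotDr ih add0r /rdot linearZr_LR/=.
by case: (xy N) => ->; rewrite ?rmorph0 ?mul0r ?mulr0.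
Qed.

End Fourier.

(** Linearity and continuity extend the identity first in [x], then in [y]. The scalar [c] in
    [step1] is carried along because [rdot] is only real bilinear. *)
Lemma hilbert_basis_adjoint K H (e : nat -> K) (f : nat -> H) (T : H -> K) (T' : K -> H) :
  hilbert_basis e -> hilbert_basis f -> bounded_op T -> bounded_op T' ->
  (forall i j, hdot (T (f i)) (e j) = hdot (f i) (T' (e j))) ->
  forall x y, rdot (T x) y = rdot x (T' y).
Proof.
move=> [oe te] [of_ tf] [lT cT] [lT' cT'] TT'.
have uniq (u : nat -> R) (l1 l2 : R) : u @ \oo --> l1 -> u @ \oo --> l2 -> l1 = l2.
  by move=> u1 u2; apply: (@cvg_unique _ _ _ _ _ _ u1 u2).
have step1 c j x : rdot (T x) (c *: e j) = rdot x (T' (c *: e j)).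
  have cx := @fourier_cvg _ f of_ tf x; set s := fourier_sum _ _ in cx.
  apply: (uniq (fun N => rdot (T (s N)) (c *: e j))).
    by apply: cvg_rdotl; exact: (cvg_comp _ _ cx (cT x)).
  rewrite (_ : (fun N => _) = (fun N => rdot (s N) (T' (c *: e j)))); first exact: cvg_rdotl.
  apply/funext; elim=> [|N ih]; first by rewrite /s /fourier_sum big_ord0 (lin0 lT) !rdot0l.
  rewrite /s /fourier_sum big_ord_recr/= (lin_add lT) !rdotDl -/(fourier_sum _ _ _) -/(s N) ih.
  by rewrite (lin_scale lT) (lin_scale lT') /rdot !hdotZl !linearZr_LR/= TT'.
move=> x y; have cy := @fourier_cvg _ e oe te y; set s := fourier_sum _ _ in cy.
apply: (uniq _ _ _ (cvg_rdotr (z := T x) cy)).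
rewrite (_ : (fun N => _) = (fun N => rdot x (T' (s N)))).
  by apply: cvg_rdotr; exact: (cvg_comp _ _ cy (cT' y)).
apply/funext; elim=> [|N ih]; first by rewrite /s /fourier_sum big_ord0 (lin0 lT') !rdot0r.
rewrite /s /fourier_sum big_ord_recr/= (lin_add lT') !rdotDr.
by rewrite -/(fourier_sum _ _ _) -/(s N) ih step1.
Qed.

(** [T x] is the vector with coefficients [hdot x (r n)]; it is linear in [x] because coefficients
    determine a vector. *)
Lemma op_of_coef K H (e : nat -> K) (r : nat -> H) (B : R) : hilbert_basis e ->
  (forall x N, \sum_(i < N) sqn (hdot x (r i)) <= B * rdot x x) ->
  exists T : H -> K, [/\ bounded_op T, forall x n, hdot (T x) (e n) = hdot x (r n) &
     forall x, rdot (T x) (T x) <= B * rdot x x].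
Proof.
move=> [oe te] rB.
have /choice[T hT] (x : H) : exists y : K, (forall n, hdot y (e n) = hdot x (r n)) /\
    rdot y y <= B * rdot x x.
  by have [y [_ h1 h2]] := riesz_fischer (c := fun i => hdot x (r i)) oe (rB x); exists y.
have lT : linear T.
  move=> a x y; apply: (eq_fourier te) => n; rewrite (hT _).1 !linearDl/= !hdotZl.
  by rewrite !(hT _).1.
exists T; split=> [|x n|x]; [|exact: (hT x).1|exact: (hT x).2].
apply: (bounded_op_rnorm (c := Num.sqrt `|B|) lT) => x.
rewrite -(@ler_pXn2r _ 2) ?nnegrE ?rnorm_ge0 ?mulr_ge0 ?sqrtr_ge0 ?rnorm_ge0//.
rewrite exprMn sqr_sqrtr// !rnorm_sqr; apply: le_trans (hT x).2 _.
by rewrite ler_wpM2r ?rdot_ge0// ler_norm.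
Qed.

(** [U] sends each [f n] to [e n] by copying coefficients; Bessel's inequality supplies the bound
    1. *)
Lemma unitary_ex K H (e : nat -> K) (f : nat -> H) : hilbert_basis e -> hilbert_basis f ->
  exists (U : H -> K) (U' : K -> H),
    [/\ bounded_op U, bounded_op U', forall x y, rdot (U x) y = rdot x (U' y),
        (forall x, U' (U x) = x) /\ (forall y, U (U' y) = y) &
        (forall x n, hdot (U x) (e n) = hdot x (f n)) /\
        (forall y n, hdot (U' y) (f n) = hdot y (e n))].
Proof.
move=> be bf; have [oe te] := be; have [of_ tf] := bf.
have [|U [bU hU _]] := @op_of_coef _ _ _ f 1 be.
  by move=> x N; rewrite mul1r; exact: bessel.
have [|U' [bU' hU' _]] := @op_of_coef _ _ _ e 1 bf.
  by move=> x N; rewrite mul1r; exact: bessel.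
exists U, U'; split=> //.
- apply: (hilbert_basis_adjoint be bf) => // i j.
  by rewrite hU [RHS]hdotC hU' -hdotC of_ hdotC oe rmorph_nat eq_sym.
- by split=> [x|y]; [apply: (eq_fourier tf)|apply: (eq_fourier te)] => n;
    rewrite (hU, hU') (hU, hU').
Qed.

End OrthonormalSequences.

(** * An operator range transversal to two complementary subspaces *)

Section TransversalRange.
Variables (R : realType) (K : hilbertType R) (e : nat -> K).
Hypothesis be : hilbert_basis e.

Local Notation h := (2^-1 : R).

Lemma half_pow_le (m n : nat) : (m <= n)%N -> h ^+ n <= h ^+ m.
Proof. by move=> mn; apply: ler_wiXn2l => //; lra. Qed.

Lemma half_pow_gt0 n : 0 < h ^+ n.
Proof. by rewrite exprn_gt0//; lra. Qed.

Lemma half_pow_sum N : \sum_(i < N) h ^+ i.+1 <= 1.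
Proof.
suff -> : \sum_(i < N) h ^+ i.+1 = 1 - h ^+ N by have := half_pow_gt0 N; lra.
elim: N => [|N ih]; first by rewrite big_ord0 expr0 subrr.
by rewrite big_ord_recr/= ih exprS; field.
Qed.

Lemma half_pow_sum_le (f : nat -> R) (B : R) N : 0 <= B ->
  (forall i, f i <= B * h ^+ i.+1) -> \sum_(i < N) f i <= B.
Proof.
move=> B0 fB; apply: (@le_trans _ _ (\sum_(i < N) B * h ^+ i.+1)).
  by apply: ler_sum.
by rewrite -mulr_sumr ler_piMr// half_pow_sum.
Qed.

(* On the even indices this is an infinite matrix whose columns decay at strictly
   different exponential rates; on the odd ones it is diagonal with entries decaying
   faster than every exponential. *)
Definition decay n m : R :=
  if (n == m) || (~~ odd n && ~~ odd m) then h ^+ (n.+1 * m.+1) else 0.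

Lemma decayC n m : decay n m = decay m n.
Proof. by rewrite /decay eq_sym andbC mulnC. Qed.

Lemma decay_sqr n m : decay n m ^+ 2 <= h ^+ (2 * (n.+1 * m.+1)).
Proof.
rewrite /decay; case: ifP => _; first by rewrite -exprM mulnC.
by rewrite expr0n/= ltW// half_pow_gt0.
Qed.

(** Exchanges [2k] and [2k + 1]; [J] below permutes the basis accordingly. *)
Definition swap n := if odd n then n.-1 else n.+1.

Lemma swapK : involutive swap.
Proof.
case=> [|n]//; rewrite /swap/=.
by have [on|/negbTE on] := boolP (odd n); rewrite /= on.
Qed.

(** [D] has the matrix [decay]. If [J (D a)] is [D a] or [- D a], each even coordinate of [D a] has
    the modulus of the next, far smaller, odd one. This annihilates first the even coordinates of
    [a], then the odd ones. *)
Lemma transversal_ex : exists D J : K -> K,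
  [/\ bounded_op D /\ rsym D, bounded_op J /\ rsym J, forall x, J (J x) = x,
      forall x, rnorm (D x) <= rnorm x &
      forall a, J (D a) = D a \/ J (D a) = - D a -> a = 0].
Proof.
have [oe te] := be.
have /choice[r hr] n : exists r : K, (forall m, hdot r (e m) = (decay n m)%:C) /\
    rdot r r <= h ^+ n.+1.
  have [|r [_ h1 h2]] := riesz_fischer (c := fun m => (decay n m)%:C) (B := h ^+ n.+1) oe.
    move=> N; apply: (@half_pow_sum_le (fun m => sqn (decay n m)%:C)) => [|m].
      exact/ltW/half_pow_gt0.
    by rewrite sqn_real (le_trans (decay_sqr _ _))// -exprD half_pow_le//; nia.
  by exists r.
(* Hilbert-Schmidt bound: the squared norms of the rows [r n] sum to at most 1. *)
have [|D [bD hD D1]] := @op_of_coef _ K K e r 1 be.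
  move=> x N; rewrite mul1r.
  apply: (@half_pow_sum_le (fun n => sqn (hdot x (r n)))) => [|n]; first exact: rdot_ge0.
  by apply: le_trans (sqn_hdot _ _) _; rewrite ler_wpM2l ?rdot_ge0//; exact: (hr n).2.
have conj_real (x : R) : conjC x%:C = x%:C.
  by apply/eqP; rewrite eq_complex /= oppr0 !eqxx.
have er i j : hdot (e i) (r j) = (decay j i)%:C by rewrite hdotC (hr j).1 conj_real.
have sD : rsym D.
  apply: (hilbert_basis_adjoint be be) => // i j.
  by rewrite hD er [RHS]hdotC hD er decayC conj_real.
have bs : hilbert_basis (e \o swap).
  split=> [i j|x hx]; first by rewrite /= oe (inj_eq (inv_inj swapK)).
  by apply: te => n; rewrite -(swapK n); exact: hx.
have [J [J' [bJ _ JJ' [J'K _] [hJ hJ']]]] := unitary_ex be bs.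
have J'E y : J' y = J y.
  by apply: (eq_fourier te) => n; rewrite hJ -{1}(swapK n); exact: hJ'.
exists D, J; split=> //.
- by split=> // x y; rewrite JJ' J'E.
- by move=> x; rewrite -J'E J'K.
- by move=> x; rewrite rnorm_le -[leRHS]mul1r; exact: D1.
move=> a Ja; pose A := rdot a a; have A0 : 0 <= A by exact: rdot_ge0.
(* Moduli do not see the sign, so both eigenspaces are treated at once. *)
have swap_sqn n : ~~ odd n -> sqn (hdot a (r n)) = sqn (hdot a (r n.+1)).
  move=> en; rewrite -!hD -[e n.+1]/((e \o id) n.+1).
  have := hJ (D a) n; rewrite /= /swap (negbTE en) => <-.
  by case: Ja => ->; rewrite ?linearNl/= ?sqnN.
have r_odd n : odd n -> r n = (h ^+ (n.+1 * n.+1))%:C *: e n.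
  move=> on; apply: (eq_fourier te) => m; rewrite (hr n).1 hdotZl oe /decay on/= orbF.
  by case: eqP => [->|_]; rewrite ?mulr1 ?mulr0.
have sqn_odd n : odd n ->
    sqn (hdot a (r n)) = h ^+ (2 * (n.+1 * n.+1)) * sqn (hdot a (e n)).
  by move=> on; rewrite r_odd// linearZr_LR/= sqnM sqn_conj sqn_real -exprM mulnC.
have sqn_e n : sqn (hdot a (e n)) <= A.
  by apply: le_trans (sqn_hdot _ _) _; rewrite (rdot_basis oe) mulr1.
(* If [N] is the first even index with [w = a_N != 0], then [(a, r n)] is of order
   [w 2^-((n+1)(N+1))] for large even [n], whereas [J (D a) = D a] or [- D a] makes it as
   small as the coordinate of [D a] at [n + 1]. *)
have even0 N : ~~ odd N -> hdot a (e N) = 0.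
  elim/ltn_ind: N => N ih eN; set w := hdot a (e N).
  have wb n : ~~ odd n -> (N < n)%N -> sqn w <= 4 * A * h ^+ n.+1.
    move=> en Nn; set g := h ^+ (2 * (n.+1 * N.+1)).
    have g0 : 0 < g by exact: half_pow_gt0.
    pose c i := (decay n i)%:C.
    (* [t] is the row without its entries up to [N]; its squared norm is below [g], the squared
       entry at [N], by the factor [h ^+ n.+1]. *)
    pose t := r n - fourier_sum e c N.+1.
    have tt : rdot t t <= g * h ^+ n.+1.
      apply: (rdot_le_fourier oe te) => M.
      apply: (@half_pow_sum_le (fun i => sqn (hdot t (e i)))) => [|i].
        by rewrite mulr_ge0// ltW// half_pow_gt0.
      rewrite /t linearBl/= (hr n).1 hdot_fourier_sum//; case: ltnP => Ni.
        by rewrite subrr (_ : 0 = 0%:C)// sqn_real expr0n/= !mulr_ge0// ltW// half_pow_gt0.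
      rewrite subr0 sqn_real; apply: le_trans (decay_sqr _ _) _.
      by rewrite /g -!exprD half_pow_le//; nia.
    have at_ : hdot a t = hdot a (r n) - (decay n N)%:C * w.
      rewrite /t linearBr/=; congr (_ - _).
      rewrite /fourier_sum big_ord_recr/= linearDr/= linear_sumr big1 ?add0r.
        by rewrite linearZr_LR -/w; congr (_ * _); exact: conj_real.
      (* Below [N], even coordinates of [a] vanish by induction, and odd entries of the even row [n]
         are zero. *)
      move=> i _; rewrite linearZr_LR/=.
      have [oi|ei] := boolP (odd i); last by rewrite ih ?mulr0.
      rewrite /c /decay en oi/= orbF gtn_eqF ?rmorph0 ?mul0r//.
      exact: ltn_trans (ltn_ord i) Nn.
    have dn : decay n N = h ^+ (n.+1 * N.+1) by rewrite /decay en eN orbT.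
    have : g * sqn w <= g * (4 * A * h ^+ n.+1).
      have -> : g * sqn w = sqn (hdot a (r n) - hdot a t).
        by rewrite at_ opprB addrC subrK sqnM sqn_real dn -exprM mulnC.
      apply: le_trans (sqnB_le _ _) _.
      have h1 : sqn (hdot a (r n)) <= A * (g * h ^+ n.+1).
        rewrite swap_sqn// sqn_odd// mulrC; apply: ler_pM.
        - exact: sqn_ge0.
        - exact/ltW/half_pow_gt0.
        - exact: sqn_e.
        - by rewrite /g -exprD half_pow_le//; nia.
      have h2 : sqn (hdot a t) <= A * (g * h ^+ n.+1).
        by apply: le_trans (sqn_hdot _ _) _; rewrite ler_wpM2l.
      lra.
    by rewrite ler_pM2l.
  apply: sqn_eq0.
  have lim : 4 * A * h ^+ k @[k --> \oo] --> (0 : R).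
    rewrite -(mulr0 (4 * A)); apply: cvgMr; apply: cvg_expr.
    by rewrite ger0_norm; lra.
  apply: (cvg_le (cvg_cst (sqn w)) lim) => k /=.
  (* An even index above both [N] and [k]. *)
  apply: le_trans (wb (2 * (N + k).+1)%N _ _) _.
  - by rewrite oddM.
  - by lia.
  - by rewrite ler_wpM2l ?mulr_ge0// half_pow_le//; lia.
have r0 n : ~~ odd n -> hdot a (r n) = 0.
  move=> en.
  (* [a] now lives on the odd indices and row [n] on the even ones; [c] is 1 or ['i], to reach both
     parts of the product. *)
  have disj c : rdot (c *: a) (r n) = 0.
    apply: (rdot_fourier_disjoint oe te) => m.
    have [om|em] := boolP (odd m); [right|left; by rewrite hdotZl even0 ?mulr0].
    rewrite (hr n).1 /decay en om/= orbF; case: eqP => // nm.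
    by move: en; rewrite nm om.
  apply/eqP; rewrite eq_complex Im_hdot disj oppr0 eqxx andbT.
  by have := disj 1; rewrite scale1r /rdot => ->.
apply: te => m; have [om|] := boolP (odd m); last exact: even0.
case: m om => // m om; have em : ~~ odd m by [].
apply: sqn_eq0; have := swap_sqn _ em; rewrite r0// sqn_odd//.
rewrite (_ : 0 = 0%:C :> R[i])// sqn_real expr0n/= => /esym/eqP.
by rewrite mulf_eq0 gt_eqF ?half_pow_gt0//= => /eqP ->.
Qed.

End TransversalRange.

(** * The two constructions *)

Lemma contractive_block_ex (R : realType) (K H : hilbertType R) :
  separable_space K -> separable_space H -> hdim_infinite K -> hdim_infinite H ->
  exists (X11 : K -> K) (X12 : H -> K) (X22 : H -> H),
    [/\ bounded_op X11, bounded_op X12 & bounded_op X22] /\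
    let X := block_op X11 X12 (adjoint X12) X22 in
    [/\ selfadjoint X /\ contractive X,
        shorted (idfun \- X) (summand2 K H) = cst 0 /\
        shorted (idfun \+ X) (summand2 K H) = cst 0,
        opnorm X22 < 1,
        op_ker (adjoint X12) = [set 0] &
        [/\ Zhat0 X <> \- idfun,
            Zhat1 X <> idfun &
            op_ker (Zhat1 X \- Zhat0 X) = [set 0]]].
Proof.
move=> sepK sepH infK infH.
have [e be] := separable_hilbert_basis sepK infK.
have [f bf] := separable_hilbert_basis sepH infH.
have [U [U' [bU bU' UU' [U'K UK] _]]] := unitary_ex be bf.
have [D0 [J [[bD0 sD0] [bJ sJ] JK D0le DJ]]] := transversal_ex be.
have [lD0 _] := bD0; have [lJ _] := bJ.
have D00 a : D0 a = 0 -> a = 0 by move=> h; apply: DJ; left; rewrite h (lin0 lJ).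
have lP : linear (D0 \o D0) by exact: (bounded_op_comp bD0 bD0).1.
have sP : rsym (D0 \o D0) by move=> x y; rewrite /= !sD0.
have P1 x : rnorm ((D0 \o D0) x) <= rnorm x by exact: le_trans (D0le _) (D0le _).
have [S [nS SS SC]] := sqrt_one_sub_ex lP sP P1.
have [[lS cS] _] := nS; have sS := nonnegative_sym nS.
have SD x : D0 (S x) = S (D0 x) by exact: SC.
have bS : bounded_op S by [].
(* [S b = D0 a] with [b] in an eigenspace of [J] gives [b = S (S b) + D0 (D0 b)]
   in the range of [D0]. *)
have SJ a b : J b = b \/ J b = - b -> D0 a = S b -> a = 0.
  move=> Jb ab.
  have bE : b = D0 (S a + D0 b).
    by rewrite (lin_add lD0) SD ab SS /= subrK.
  have /DJ Sab : J (D0 (S a + D0 b)) = D0 (S a + D0 b) \/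
      J (D0 (S a + D0 b)) = - D0 (S a + D0 b) by rewrite -bE.
  by apply: D00; rewrite ab bE Sab (lin0 lD0) (lin0 lS).
(* Otherwise [DJ] gives [S = 0], so [D0] squares to the identity and is onto; by [DJ] again [J] has
   no nonzero eigenvector for 1 or -1, which is absurd as [J] is an involution and [e 0] is
   nonzero. *)
have JS : ~ forall k, J (S k) = S k \/ J (S k) = - S k.
  move=> h.
  have S0 k : S k = 0 by apply: DJ; rewrite SD; exact: h.
  have DDk k : D0 (D0 k) = k by have := SS k; rewrite !S0 => /esym/eqP; rewrite subr_eq0 => /eqP.
  have Jz x : J x = x \/ J x = - x -> x = 0.
    by move=> Jx; rewrite -(DDk x) (DJ (D0 x)) ?(lin0 lD0)// DDk.
  have e00 : e 0%N = 0.
    have : J (e 0%N) - e 0%N = 0 by apply: Jz; right; rewrite (lin_sub lJ) JK opprB.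
    by move=> /eqP; rewrite subr_eq0 => /eqP ?; apply: Jz; left.
  by have := rdot_basis be.1 0; rewrite e00 rdot0l => /eqP; rewrite eq_sym oner_eq0.
have bD : bounded_op (D0 \o U) by exact: bounded_op_comp.
have bD' : bounded_op (U' \o D0) by exact: bounded_op_comp.
have DD' h k : rdot ((D0 \o U) h) k = rdot h ((U' \o D0) k) by rewrite /= sD0 UU'.
pose X11 := S \o (J \o S).
have b11 : bounded_op X11 by do 2 apply: bounded_op_comp => //.
have s11 : rsym X11 by move=> x y; rewrite /X11 /= sS sJ sS.
pose q : R[i] := (Num.sqrt 2^-1)%:C.
have qq x : q *: (q *: x) = (2^-1)%:C *: x :> K.
  by rewrite scalerA -rmorphM -expr2 sqr_sqrtr.
(* When [s ^+ 2 = 1], [q (1 + s J)] has square [1 + s J], so [T s] after [T' s] is [S (1 + s J) S].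
   The signs 1 and -1 serve [I + X] and [I - X]. *)
pose T (s : R) g := S (q *: (g + s%:C *: J g)).
pose T' (s : R) k := q *: (S k + s%:C *: J (S k)).
have lT s : linear (T s).
  have bIJ := bounded_opD (bounded_op_id K) (bounded_opZ s%:C bJ).
  exact: (bounded_op_comp bS (bounded_opZ q bIJ)).1.
have TT' s g k : rdot (T s g) k = rdot g (T' s k).
  by rewrite /T /T' sS /q !rdotE sJ.
have TTE s k : s ^+ 2 = 1 -> k + s%:C *: X11 k - (D0 \o U) ((U' \o D0) k) = T s (T' s k).
  move=> s2; rewrite /= UK addrAC -[_ - _]SS /T /T' /X11 /=.
  have -> : S (S k) + s%:C *: S (J (S k)) = S (S k + s%:C *: J (S k)).
    by rewrite (lin_add lS) (lin_scale lS).
  congr S; move: (S k) => v.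
  rewrite (lin_scale lJ) scalerA [s%:C * q]mulrC -scalerA -scalerDr qq.
  have -> : s%:C *: J (v + s%:C *: J v) = v + s%:C *: J v.
    by rewrite (lin_add lJ) (lin_scale lJ) JK scalerDr scalerA -rmorphM -expr2 s2 scale1r addrC.
  by rewrite half_add.
have DT s h g : s = 1 \/ s = -1 -> (D0 \o U) h = T s g -> h = 0.
  move=> s1 /(SJ _ _ _) Uh; rewrite -(U'K h) Uh ?(lin0 bU'.1)//.
  have s2 : s ^+ 2 = 1 by case: s1 => ->; rewrite ?sqrrN expr1n.
  rewrite (lin_scale lJ) (lin_add lJ) (lin_scale lJ) JK.
  by case: s1 => ->; [left|right]; rewrite ?rmorphN /= ?scaleN1r ?scale1r;
    rewrite -?scalerN ?opprB 1?addrC.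
have A1 k : k + X11 k - (D0 \o U) ((U' \o D0) k) = T 1 (T' 1 k).
  by rewrite -TTE ?expr1n// scale1r.
have A2 k : k - X11 k - (D0 \o U) ((U' \o D0) k) = T (-1) (T' (-1) k).
  by rewrite -TTE ?sqrrN ?expr1n// rmorphN/= scaleN1r.
have [XX [Xs1 Xs2] Z0 Z1] := shorted_contraction b11 s11 bD bD' DD' (lT 1) (lT (-1))
  (TT' 1) (TT' (-1)) A1 A2 (fun h g => DT 1 h g (or_introl erefl))
  (fun h g => DT (-1) h g (or_intror erefl)).
pose X := block_op X11 (D0 \o U) (adjoint (D0 \o U)) (cst 0 : H -> H).
exists X11, (D0 \o U), (cst 0); split; first by split=> //; exact: bounded_op0.
have adjE : adjoint (D0 \o U) = U' \o D0 by exact: adjoint_eq bD.1 bD' DD'.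
(* The form of [T s] after [T' s] at [k] is [|T' s k|^2]; multiplying [T' s k = 0] by [2 q] removes
   the factor [q]. *)
have TT0 s : s ^+ 2 = 1 -> (forall k, T s (T' s k) = 0) -> forall k, S k + s%:C *: J (S k) = 0.
  move=> s2 h k; have : T' s k = 0 by apply: rdot_eq0; rewrite -TT' h rdot0l.
  by move=> /(congr1 (fun z => q *: (z + z))); rewrite addr0 scaler0 scalerDr qq -scalerDr half_add.
split=> //.
- by rewrite opnorm0.
- rewrite adjE; apply/seteqP; split=> [k /= h|_ ->]; last exact: lin0 bD'.1.
  by apply: D00; rewrite -(UK (D0 k)) -[U' _]/((U' \o D0) k) h (lin0 bU.1).
split.
(* [Zhat0 X = - I] means that the Schur complement of [I + X] is zero, whence [J S = - S]; the other
   case is symmetric. *)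
- move=> Z0E; apply: JS => k; right.
  have : S k + 1%:C *: J (S k) = 0.
    apply: TT0 => [|k']; first by rewrite expr1n.
    by rewrite -A1 -addrA -Z0 Z0E /= subrr.
  by rewrite scale1r => /eqP; rewrite addrC addr_eq0 => /eqP.
- move=> Z1E; apply: JS => k; left.
  have : S k + (-1)%:C *: J (S k) = 0.
    apply: TT0 => [|k']; first by rewrite sqrrN expr1n.
    by rewrite -A2 -addrA -opprD -Z1 Z1E /= subrr.
  by rewrite rmorphN/= scaleN1r => /eqP; rewrite subr_eq0 => /eqP.
- have ZD k : Zhat1 X k - Zhat0 X k = D0 (D0 k) + D0 (D0 k).
    by rewrite Z0 Z1 opprB addrC addrA subrK /= UK.
  apply/seteqP; split=> [k /(etrans (esym (ZD k))) h|_ ->].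
    apply: D00; apply: rdot_eq0; move: h => /(congr1 (fun z => rdot z k)).
    by rewrite rdotDl rdot0l sD0; have := rdot_ge0 (D0 k); lra.
  by apply: etrans (ZD 0) _; rewrite !(lin0 lD0) addr0.
Qed.

Lemma contractive_block_of_Zhat (R : realType) (K : hilbertType R) (Z0 Z1 : K -> K) :
  separable_space K -> hdim_infinite K ->
  selfadjoint Z0 -> contractive Z0 ->
  selfadjoint Z1 -> contractive Z1 ->
  op_le Z0 Z1 ->
  range (op_sqrt (Z1 \- Z0)) `&` range (op_sqrt (idfun \+ Z0)) = [set 0] ->
  range (op_sqrt (Z1 \- Z0)) `&` range (op_sqrt (idfun \- Z1)) = [set 0] ->
  op_ker (Z1 \- Z0) = [set 0] ->
  exists (H : hilbertType R) (X11 : K -> K) (X12 : H -> K) (X22 : H -> H),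
    [/\ separable_space H, hdim_eq H K,
        bounded_op X11, bounded_op X12 & bounded_op X22] /\
    let X := block_op X11 X12 (adjoint X12) X22 in
    [/\ selfadjoint X /\ contractive X,
        shorted (idfun \+ X) (summand2 K H) = cst 0 /\
        shorted (idfun \- X) (summand2 K H) = cst 0,
        opnorm X22 < 1,
        Z0 = Zhat0 X &
        Z1 = Zhat1 X].
Proof.
move=> sepK [B [oB _]] /selfadjointP[b0 s0] [_ c0] /selfadjointP[b1 s1] [_ c1] le01.
move=> ran0 ran1 ker01.
have {}c0 x : rnorm (Z0 x) <= rnorm x by rewrite -lecR !rnormE.
have {}c1 x : rnorm (Z1 x) <= rnorm x by rewrite -lecR !rnormE.
(* Each of the three operators is a sum or difference of two contractions, hence bounded by 2. *)
have sqrtP A : bounded_op A -> rsym A -> (forall x, 0 <= rdot (A x) x) ->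
    (forall x, rnorm (A x) <= rnorm x + rnorm x) -> is_op_sqrt A (op_sqrt A).
  move=> bA sA A0 cA; apply: (op_sqrt_ex (c := 2)); first exact: nonnegativeI.
  by move=> x; apply: le_trans (cA x) _; lra.
have c_rdot (A : K -> K) x : (forall x, rnorm (A x) <= rnorm x) -> `|rdot (A x) x| <= rdot x x :> R.
  move=> cA; apply: le_trans (ler_norm_rdot _ _) _.
  by rewrite -rnorm_sqr expr2 ler_wpM2r ?rnorm_ge0.
have [nE EE] : is_op_sqrt (Z1 \- Z0) (op_sqrt (Z1 \- Z0)).
  apply: sqrtP.
  - exact: bounded_opB.
  - by move=> x y; rewrite /= !rdotE s0 s1.
  - by move=> x; rewrite /= rdotDl rdotNl subr_ge0 op_le_rdot.
  - by move=> x; apply: le_trans (rnormB _ _) _; rewrite lerD.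
have [n1 E1] : is_op_sqrt (idfun \+ Z0) (op_sqrt (idfun \+ Z0)).
  apply: sqrtP.
  - by apply: bounded_opD => //; exact: bounded_op_id.
  - by move=> x y; rewrite /= !rdotE s0.
  - by move=> x; have := c_rdot _ x c0; rewrite ler_norml /= rdotDl; lra.
  - by move=> x; apply: le_trans (rnormD _ _) _; rewrite lerD.
have [n2 E2] : is_op_sqrt (idfun \- Z1) (op_sqrt (idfun \- Z1)).
  apply: sqrtP.
  - by apply: bounded_opB => //; exact: bounded_op_id.
  - by move=> x y; rewrite /= !rdotE s1.
  - by move=> x; have := c_rdot _ x c1; rewrite ler_norml /= rdotDl rdotNl; lra.
  - by move=> x; apply: le_trans (rnormB _ _) _; rewrite lerD.
move: ran0 ran1 nE EE n1 E1 n2 E2.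
set E := op_sqrt (Z1 \- Z0); set T1 := op_sqrt _; set T2 := op_sqrt _.
move=> ran0 ran1 nE EE n1 E1 n2 E2.
have {}EE x : E (E x) = Z1 x - Z0 x by rewrite -[LHS]/((E \o E) x) EE.
have {}E1 x : x + Z0 x = T1 (T1 x) by rewrite -[RHS]/((T1 \o T1) x) E1.
have {}E2 x : x - Z1 x = T2 (T2 x) by rewrite -[RHS]/((T2 \o T2) x) E2.
have [bE _] := nE; have sE := nonnegative_sym nE; have lE := bE.1.
pose q : R[i] := (Num.sqrt 2^-1)%:C.
have q0 : q != 0 by rewrite gt_eqF// ltcR sqrtr_gt0.
have qq x : q *: (q *: x) = (2^-1)%:C *: x :> K.
  by rewrite scalerA -rmorphM -expr2 sqr_sqrtr.
(* The square root of [(Z1 - Z0) / 2]; a nonzero scalar leaves the range of [E] unchanged. *)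
pose D : K -> K := q \*: E.
have bD : bounded_op D by exact: bounded_opZ.
have DD h k : rdot (D h) k = rdot h (D k) by rewrite /D /q /= !rdotE sE.
have DDE k : D (D k) = (2^-1)%:C *: (Z1 k - Z0 k).
  by rewrite /D /= (lin_scale lE) qq EE.
pose X11 : K -> K := (2^-1)%:C \*: (Z0 \+ Z1).
have b11 : bounded_op X11 by apply: bounded_opZ; exact: bounded_opD.
have s11 : rsym X11 by move=> x y; rewrite /X11 /= !rdotE s0 s1.
have Z0E k : X11 k - D (D k) = Z0 k.
  by rewrite DDE /X11 /= -scalerBr opprB addrACA subrr addr0 half_add.
have Z1E k : X11 k + D (D k) = Z1 k.
  by rewrite DDE /X11 /= -scalerDr addrC addrA subrK half_add.
(* Transversality yields [E h = 0], hence [(Z1 - Z0) h = E (E h) = 0], and the kernel hypothesis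
   gives [h = 0]. *)
have DT (T : K -> K) h g : range E `&` range T = [set 0] -> D h = T g -> h = 0.
  move=> ran hg.
  have : [set 0] (D h).
    rewrite -ran; split; last by exists g.
    by exists (q *: h) => //; rewrite (lin_scale lE).
  move=> /eqP; rewrite scaler_eq0 (negbTE q0)/= => /eqP Eh.
  by have : [set 0] h by rewrite -ker01 /op_ker /= -EE Eh (lin0 lE).
have A1 k : k + X11 k - D (D k) = T1 (T1 k) by rewrite -addrA Z0E E1.
have A2 k : k - X11 k - D (D k) = T2 (T2 k) by rewrite -addrA -opprD Z1E E2.
have [XX [Xs1 Xs2] ZZ0 ZZ1] := shorted_contraction b11 s11 bD bD DD n1.1.1 n2.1.1
  (nonnegative_sym n1) (nonnegative_sym n2) A1 A2
  (fun h g => DT T1 h g ran0) (fun h g => DT T2 h g ran1).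
(* Taking [H = K] settles separability and dimension. *)
exists K, X11, D, (cst 0); split.
  split=> //; last exact: bounded_op0.
  by exists B, B; split=> //; exact: card_eqxx.
split=> //.
- by rewrite opnorm0.
- by apply/funext => k; rewrite ZZ0 Z0E.
- by apply/funext => k; rewrite ZZ1 Z1E.
Qed.

Theorem theorem3p6 (R : realType) :
  (forall K H : hilbertType R,
     separable_space K -> separable_space H -> hdim_infinite K -> hdim_infinite H ->
     exists (X11 : K -> K) (X12 : H -> K) (X22 : H -> H),
       [/\ bounded_op X11, bounded_op X12 & bounded_op X22] /\
       let X := block_op X11 X12 (adjoint X12) X22 in
       [/\ selfadjoint X /\ contractive X,
           shorted (idfun \- X) (summand2 K H) = cst 0 /\
           shorted (idfun \+ X) (summand2 K H) = cst 0,
           opnorm X22 < 1,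
           op_ker (adjoint X12) = [set 0] &
           [/\ Zhat0 X <> \- idfun,
               Zhat1 X <> idfun &
               op_ker (Zhat1 X \- Zhat0 X) = [set 0]]])
  /\
  (forall (K : hilbertType R) (Z0 Z1 : K -> K),
     separable_space K -> hdim_infinite K ->
     selfadjoint Z0 -> contractive Z0 ->
     selfadjoint Z1 -> contractive Z1 ->
     op_le Z0 Z1 ->
     range (op_sqrt (Z1 \- Z0)) `&` range (op_sqrt (idfun \+ Z0)) = [set 0] ->
     range (op_sqrt (Z1 \- Z0)) `&` range (op_sqrt (idfun \- Z1)) = [set 0] ->
     op_ker (Z1 \- Z0) = [set 0] ->
     exists (H : hilbertType R) (X11 : K -> K) (X12 : H -> K) (X22 : H -> H),
       [/\ separable_space H, hdim_eq H K,
           bounded_op X11, bounded_op X12 & bounded_op X22] /\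
       let X := block_op X11 X12 (adjoint X12) X22 in
       [/\ selfadjoint X /\ contractive X,
           shorted (idfun \+ X) (summand2 K H) = cst 0 /\
           shorted (idfun \- X) (summand2 K H) = cst 0,
           opnorm X22 < 1,
           Z0 = Zhat0 X &
           Z1 = Zhat1 X]).
Proof.
split; [exact: contractive_block_ex|exact: contractive_block_of_Zhat].
Qed.
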